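(* Let $n\ge1$ and let $\mu=\mu_1\otimes\cdots\otimes\mu_n$ be a product probability measure on the discrete hypercube $\{0,1\}^n$ with $\mu_i(1)=1-\mu_i(0)=\alpha_i\in(0,1)$. Let $L$ be the generator $L(z,\sigma_i(z))=(1-\alpha_i)z_i+\alpha_i(1-z_i)$ for $i\in\{1,\dots,n\}$, $L(z,z)=-\sum_{i=1}^nL(z,\sigma_i(z))$, and $L(z,w)=0$ otherwise, where $\sigma_i(z)$ is obtained from $z$ by replacing $z_i$ with $1-z_i$. For all probability measures $\nu_0,\nu_1$ on $\{0,1\}^n$, with associated zero-temperature coupling $\widehat\pi$ and Schrödinger bridge at zero temperature $(\widehat Q_t)_{t\in[0,1]}$ from $\nu_0$ to $\nu_1$, one has for all $t\in(0,1)$ $$H(\widehat Q_t|\mu)\le(1-t)H(\nu_0|\mu)+tH(\nu_1|\mu)-\frac{t(1-t)}2\,C_t(\widehat\pi),$$ with $$C_t(\widehat\pi)=\max\Big[\frac4n W_1^2(\nu_0,\nu_1),\ \frac4n T_{c_2}(\widehat\pi),\ \widetilde T_t(\widehat\pi)\Big],$$ where $T_{c_2}(\widehat\pi)=\iint c_2(d(x,y))\,d\widehat\pi(x,y)$ with $$c_2(k)=\max\Big\{\frac{k(k-1)}2,\ k^2-2k(1+\log k)\mathbf 1_{k\ne0}\Big\},\qquad k\in\mathbb N,$$ and $$\widetilde T_t(\widehat\pi)=\int\sum_{i=1}^nh_t\big(\Pi^i_\rightarrow(x)\big)d\nu_0(x)+\int\sum_{i=1}^nh_{1-t}\big(\Pi^i_\leftarrow(y)\big)d\nu_1(y),$$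 $$\Pi^i_\rightarrow(x)=\int\mathbf 1_{w_i\ne x_i}\,d\widehat\pi_\rightarrow(w|x),\qquad \Pi^i_\leftarrow(y)=\int\mathbf 1_{w_i\ne y_i}\,d\widehat\pi_\leftarrow(w|y).$$
   Context: $d(x,y)=\sum_{i=1}^n\mathbf 1_{x_i\ne y_i}$ is the Hamming distance, $[x,y]=\{z:d(x,z)+d(z,y)=d(x,y)\}$, $W_1(\nu_0,\nu_1)=\inf_\pi\iint d\,d\pi$ over couplings of $\nu_0,\nu_1$, and $H(q|\mu)=\sum_zq(z)\log\frac{q(z)}{\mu(z)}$ ($0\log0=0$). For $t\in(0,1)$ and $u\in[0,1]$, $h_t(u)=\frac{t\,h(u)-h(tu)}{t(1-t)}$ with $h(u)=2[(1-u)\log(1-u)+u]$. Zero-temperature coupling and bridge. For $\gamma>0$, $t\ge0$ let $P_t^\gamma=e^{\gamma tL}$ and $P_t^\gamma f(x)=\sum_yP_t^\gamma(x,y)f(y)$. Let $f^\gamma,g^\gamma\ge0$ solve $f^\gamma(x)\,P_1^\gamma g^\gamma(x)=\nu_0(x)/\mu(x)$ and $g^\gamma(y)\,P_1^\gamma f^\gamma(y)=\nu_1(y)/\mu(y)$ for all $x,y$, and set $\widehat\pi^\gamma(x,y)=\mu(x)P_1^\gamma(x,y)f^\gamma(x)g^\gamma(y)$; this is a uniquely determined coupling of $\nu_0,\nu_1$ (the minimizer of the relative entropy with respect to $\mu(x)P_1^\gamma(x,y)$ among couplings of $\nu_0$ and $\nu_1$). It is known (Léonard) that as $\gamma\to0$,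 $\widehat\pi^\gamma$ converges to a coupling $\widehat\pi$ of $\nu_0,\nu_1$, which is $W_1$-optimal. The kernels are $\widehat\pi_\rightarrow(w|x)=\widehat\pi(x,w)/\nu_0(x)$ for $\nu_0(x)>0$ and $\widehat\pi_\leftarrow(w|y)=\widehat\pi(w,y)/\nu_1(y)$ for $\nu_1(y)>0$. The bridge is $\widehat Q_t(z)=\sum_{x,y}Q_t^{x,y}(z)\,\widehat\pi(x,y)$ with $Q_t^{x,y}(z)=\mathbf 1_{[x,y]}(z)\,t^{d(x,z)}(1-t)^{d(z,y)}$. *)

(* Defs.v *)
From HB Require Import structures.
From mathcomp Require Import all_boot all_order all_algebra.
From mathcomp Require Import all_classical all_reals all_analysis.
Import Order.TTheory GRing.Theory Num.Theory.
Import numFieldNormedType.Exports.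

Set Implicit Arguments.
Unset Strict Implicit.
Unset Printing Implicit Defensive.

Local Open Scope classical_set_scope.
Local Open Scope ring_scope.

Definition cube (n : nat) := {ffun 'I_n -> bool}.

(* Measures on the (finite) cube are given by their mass functions
   [cube n -> R]; measures on the product of two cubes, and kernels, by
   functions [cube n -> cube n -> R]. *)

Definition hamming n (x y : cube n) : nat := (\sum_(i < n) (x i != y i))%N.

Definition segment n (x y : cube n) : {set cube n} :=
  [set z : cube n | (hamming x z + hamming z y)%N == hamming x y].

Definition flip n (i : 'I_n) (z : cube n) : cube n :=
  [ffun j => if j == i then ~~ z j else z j].

Section Measures.
Context {R : realType} {n : nat}.
Implicit Types (nu q : cube n -> R) (p : cube n -> cube n -> R).

Definition is_prob nu : Prop :=
  (forall x, 0 <= nu x) /\ \sum_x nu x = 1.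

Definition product_measure (alpha : 'I_n -> R) (z : cube n) : R :=
  \prod_(i < n) (if z i then alpha i else 1 - alpha i).

(* Since [ln 0 = 0] and a term with [q z = 0] vanishes, the convention
   0 log 0 = 0 is respected; this is meant for an everywhere positive [mu]. *)
Definition entropy q (mu : cube n -> R) : R :=
  \sum_z q z * ln (q z / mu z).

Definition is_coupling nu0 nu1 p : Prop :=
  [/\ forall x y, 0 <= p x y,
      forall x, \sum_y p x y = nu0 x &
      forall y, \sum_x p x y = nu1 y].

Definition transport_cost p : R :=
  \sum_x \sum_y (hamming x y)%:R * p x y.

Definition W1 nu0 nu1 : R :=
  inf [set transport_cost p | p in [set p | is_coupling nu0 nu1 p]].

End Measures.

Section Semigroup.
Context {R : realType} {n : nat}.
Implicit Types (A : cube n -> cube n -> R) (alpha : 'I_n -> R).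

Definition rate alpha (i : 'I_n) (z : cube n) : R :=
  (1 - alpha i) * (z i)%:R + alpha i * (1 - (z i)%:R).

(* The sum over [i] in the second branch has at most one term. *)
Definition generator alpha (z w : cube n) : R :=
  if w == z then - \sum_(i < n) rate alpha i z
  else \sum_(i < n | w == flip i z) rate alpha i z.

Fixpoint kernel_pow A (k : nat) (x y : cube n) : R :=
  if k is k'.+1 then \sum_z A x z * kernel_pow A k' z y else (x == y)%:R.

(* Matrix exponential, as the entrywise limit of the exponential series. *)
Definition kernel_exp A (x y : cube n) : R :=
  limn (series (fun k => kernel_pow A k x y / k`!%:R)).

Definition semigroup alpha (gamma t : R) : cube n -> cube n -> R :=
  kernel_exp (fun x y => gamma * t * generator alpha x y).

Definition kernel_app A (f : cube n -> R) (x : cube n) : R :=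
  \sum_y A x y * f y.

End Semigroup.

Section ZeroTemperature.
Context {R : realType} {n : nat}.
Implicit Types (alpha : 'I_n -> R) (nu : cube n -> R).
Implicit Types (p : cube n -> cube n -> R).

Definition schrodinger_coupling alpha nu0 nu1 (gamma : R) p : Prop :=
  let mu := product_measure alpha in
  let P1 := semigroup alpha gamma 1 in
  exists f g : cube n -> R,
    [/\ (forall x, 0 <= f x) /\ (forall y, 0 <= g y),
        forall x, f x * kernel_app P1 g x = nu0 x / mu x,
        forall y, g y * kernel_app P1 f y = nu1 y / mu y &
        forall x y, p x y = mu x * P1 x y * f x * g y].

Definition zero_temperature_coupling alpha nu0 nu1 p : Prop :=
  exists pi_ : R -> cube n -> cube n -> R,
    (forall gamma : R, 0 < gamma ->
       schrodinger_coupling alpha nu0 nu1 gamma (pi_ gamma)) /\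
    (forall x y, pi_ gamma x y @[gamma --> 0^'+] --> p x y).

Definition bridge_kernel (t : R) (x y z : cube n) : R :=
  (z \in segment x y)%:R * t ^+ hamming x z * (1 - t) ^+ hamming z y.

Definition bridge p (t : R) (z : cube n) : R :=
  \sum_x \sum_y bridge_kernel t x y z * p x y.

(* The conditional kernels are only meaningful where the marginal is
   positive; elsewhere division by zero makes them 0, and they are
   only ever integrated against that marginal. *)
Definition forward_kernel nu0 p (x w : cube n) : R := p x w / nu0 x.
Definition backward_kernel nu1 p (y w : cube n) : R := p w y / nu1 y.

Definition Pi_forward nu0 p (i : 'I_n) (x : cube n) : R :=
  \sum_(w : cube n) (w i != x i)%:R * forward_kernel nu0 p x w.
Definition Pi_backward nu1 p (i : 'I_n) (y : cube n) : R :=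
  \sum_(w : cube n) (w i != y i)%:R * backward_kernel nu1 p y w.

End ZeroTemperature.

Section Costs.
Context {R : realType}.

(* At [u = 1], [ln 0 = 0] gives the continuous extension [hfun 1 = 2]. *)
Definition hfun (u : R) : R := 2 * ((1 - u) * ln (1 - u) + u).

Definition hfun_t (t u : R) : R := (t * hfun u - hfun (t * u)) / (t * (1 - t)).

Definition c2 (k : nat) : R :=
  Num.max (k%:R * (k%:R - 1) / 2)
          (k%:R ^+ 2 - 2 * k%:R * (1 + ln k%:R) * (k != 0%N)%:R).

Context {n : nat}.
Implicit Types (nu : cube n -> R) (p : cube n -> cube n -> R).

Definition T_c2 p : R := \sum_x \sum_y c2 (hamming x y) * p x y.

Definition T_tilde nu0 nu1 p (t : R) : R :=
  \sum_x (\sum_(i < n) hfun_t t (Pi_forward nu0 p i x)) * nu0 x +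
  \sum_y (\sum_(i < n) hfun_t (1 - t) (Pi_backward nu1 p i y)) * nu1 y.

Definition C_cost nu0 nu1 p (t : R) : R :=
  Num.max (4 / n%:R * W1 nu0 nu1 ^+ 2)
    (Num.max (4 / n%:R * T_c2 p) (T_tilde nu0 nu1 p t)).

End Costs.

(* Main.v *)
Require Import Defs.
From mathcomp Require Import all_boot all_order all_algebra.
From mathcomp Require Import all_classical all_reals all_analysis.
From mathcomp Require Import ring lra zify.
Import Order.TTheory GRing.Theory Num.Theory.
Import numFieldNormedType.Exports.

Local Open Scope ring_scope.

(** The proof bounds the second time derivative of the entropy of the bridge
    from below and compares convexity gaps ([gap_le]).

    Only one property of the zero-temperature coupling is used besides its
    marginals. At positive temperature the coupling has the form
    [mu x * P x y * f x * g y], so that in a product over two pairs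
    [(x, y)], [(x', y')] the factors [f] and [g] survive an exchange of targets.
    As [gamma] tends to zero, [P x y] behaves like [gamma ^+ hamming x y] times a
    product of jump rates ([semigroup_asymptotics]), and the limit is the
    property [memoryless]: given the position of the bridge at a fixed time, its
    start and its target are independent ([bridge_mean_indep]). Hence a
    coordinate is flipped at most once along concatenated bridges.

    The logarithm of the product measure averages affinely along the bridge, so
    it is enough to study the sum of [Q ln Q] ([entropy_gap]). Let [a i] and [b i]
    be the masses that leave a vertex, or arrive at it, through coordinate [i] per
    unit time, and [aa i j], [bb i j] their second-order analogues. Summation by
    parts on the squares of the cube, with independence at their vertices, turns
    the second derivative into the sum over vertices of
    [\sum_i a i ^+ 2 / Q + \sum_(i != j) excess (aa i j) (a i * a j / Q)] and of
    the same expression in [b], [bb] ([second_variation]), where [excess] is a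
    nonnegative relative entropy. Each cost comes from a lower bound of this sum.

    - At a given vertex [a i] or [b i] vanishes, so that the squares dominate
      [4 / n] times the square of the transport cost, an upper bound of [W1]
      ([second_variation_ge_cost]).
    - By Jensen's inequality conditionally on the start of the bridge, the mean
      square of the rate [a i / Q] is at least [Pi ^+ 2 / (1 - t * Pi)], which is
      half the second derivative of [hfun (t * Pi)]; time reversal gives the
      backward half ([forward_speed_ge], [gap_ge_jumps]).
    - By duality for [excess], the sum is at least the sum of the [aa i j] divided
      by the number of nonzero [a i], plus the analogue for [b]. These two numbers
      add up to at most [n], and Cauchy-Schwarz leaves an explicit polynomial
      function of time and of the distance of the end points, the convexity gap
      of which involves a harmonic sum bounded by a logarithm
      ([second_variation_ge_moments], [gap_pair_potential]). *)

(** * The geometry of the cube *)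

Section Cube.
Context {n : nat}.
Implicit Types (x y z : cube n) (i j : 'I_n).

Lemma flip_same i z : flip i z i = ~~ z i.
Proof. by rewrite ffunE eqxx. Qed.

Lemma flip_other i j z : j != i -> flip i z j = z j.
Proof. by rewrite ffunE => /negbTE ->. Qed.

Lemma flipK i : involutive (flip i : cube n -> cube n).
Proof.
by move=> z; apply/ffunP => j; rewrite !ffunE; case: eqP => // _; rewrite negbK.
Qed.

Lemma flipC i j z : flip i (flip j z) = flip j (flip i z).
Proof. by apply/ffunP => k; rewrite !ffunE; do 2!case: eqP. Qed.

Lemma flip_neq i z : flip i z != z.
Proof.
by apply/eqP => /(congr1 (fun u : cube n => u i)); rewrite flip_same; case: (z i).
Qed.

Lemma sum_flip (V : nmodType) i (F : cube n -> V) :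
  \sum_z F (flip i z) = \sum_z F z.
Proof. by rewrite [RHS](reindex_inj (can_inj (flipK i))). Qed.

Lemma segmentE x y z :
  (z \in segment x y) = [forall i, (z i == x i) || (z i == y i)].
Proof.
rewrite inE /hamming -big_split /= eq_sym.
have H i : true -> ((x i != y i) <= (x i != z i) + (z i != y i)
    ?= iff ((z i == x i) || (z i == y i)))%N.
  by move=> _; case: (x i); case: (y i); case: (z i).
have [_ ->] := leqif_sum (P := predT) (fun i Hi => H i Hi).
by [].
Qed.

Lemma segmentC x y z : (z \in segment x y) = (z \in segment y x).
Proof. by rewrite !segmentE; apply: eq_forallb => i; rewrite orbC. Qed.

Lemma hamming_flip i x y :
  x i != y i -> hamming x y = (hamming (flip i x) y).+1.
Proof.
move=> xy; rewrite /hamming (bigD1 i) //= [in RHS](bigD1 i) //= flip_same xy.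
have -> : (~~ x i != y i) = false by move: xy; case: (x i); case: (y i).
congr (_ + _)%N; apply: eq_bigr => j ji; by rewrite flip_other.
Qed.

Lemma hamming_flipS i x y :
  x i = y i -> hamming (flip i x) y = (hamming x y).+1.
Proof.
move=> xy; rewrite -[x in RHS](flipK i); apply: hamming_flip.
by rewrite flip_same xy; case: (y i).
Qed.

Lemma hamming_triangle x y z : (hamming x y <= hamming x z + hamming z y)%N.
Proof.
rewrite /hamming -big_split /=; apply: leq_sum => i _.
by case: (x i); case: (y i); case: (z i).
Qed.

Lemma hammingC x y : hamming x y = hamming y x.
Proof. by apply: eq_bigr => i _; rewrite eq_sym. Qed.

Lemma hamming_eq0 x y : (hamming x y == 0%N) = (x == y).
Proof.
rewrite /hamming sum_nat_eq0; apply/forallP/eqP => [H | -> i]; last first.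
  by rewrite eqxx.
by apply/ffunP => i; have := H i; rewrite eqb0 negbK => /eqP.
Qed.

Lemma segment_hamming x y z :
  z \in segment x y -> (hamming x z + hamming z y)%N = hamming x y.
Proof. by rewrite inE => /eqP. Qed.

Lemma sum_diff_const (V : nmodType) x y (c : V) :
  \sum_(i < n | x i != y i) c = c *+ hamming x y.
Proof.
rewrite /hamming big_mkcond /= -sumrMnr; apply: eq_bigr => i _.
by case: ifP.
Qed.

End Cube.

(** * Short-time asymptotics of the semigroup *)

Section Kernels.
Context {R : realType} {n : nat}.
Implicit Types (A : cube n -> cube n -> R) (alpha : 'I_n -> R).
Implicit Types (x y z : cube n) (i j : 'I_n).

Lemma kernel_powZ A (c : R) k x y :
  kernel_pow (fun u v => c * A u v) k x y = c ^+ k * kernel_pow A k x y.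
Proof.
elim: k x => [|k IH] x /=; first by rewrite expr0 mul1r.
by rewrite mulr_sumr; apply: eq_bigr => z _; rewrite IH exprS; ring.
Qed.

Lemma kernel_powSr A k x y :
  kernel_pow A k.+1 x y = \sum_z kernel_pow A k x z * A z y.
Proof.
elim: k x => [|k IH] x.
  rewrite /= (bigD1 y) //= eqxx mulr1 big1 ?addr0; last first.
    by move=> z /negbTE ->; rewrite mulr0.
  rewrite (bigD1 x) //= eqxx mul1r big1 ?addr0 // => z.
  by rewrite eq_sym => /negbTE ->; rewrite mul0r.
transitivity (\sum_z A x z * kernel_pow A k.+1 z y) => //.
under eq_bigr do rewrite IH mulr_sumr.
rewrite exchange_big /=; apply: eq_bigr => z _; rewrite mulr_suml.
by apply: eq_bigr => w _; rewrite mulrA.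
Qed.

Lemma kernel_pow_reversible (m : cube n -> R) A :
  (forall x y, m x * A x y = m y * A y x) ->
  forall k x y, m x * kernel_pow A k x y = m y * kernel_pow A k y x.
Proof.
move=> H; elim=> [|k IH] x y; first by rewrite /= eq_sym; case: eqP => [->|]//; rewrite !mulr0.
rewrite kernel_powSr /= !mulr_sumr; apply: eq_bigr => z _.
by rewrite mulrA IH mulrAC H mulrCA; ring.
Qed.

Lemma kernel_pow_le A : exists2 C : R, 0 <= C &
  forall k x y, `|kernel_pow A k x y| <= C ^+ k.
Proof.
exists (\sum_x \sum_z `|A x z|); first by rewrite !sumr_ge0// => x _; rewrite sumr_ge0.
elim=> [|k IH] x y /=; first by rewrite expr0 normr_nat lern1 leq_b1.
rewrite exprS (le_trans (ler_norm_sum _ _ _))//.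
apply: (@le_trans _ _ ((\sum_z `|A x z|) * (\sum_u \sum_z `|A u z|) ^+ k)).
  rewrite mulr_suml ler_sum// => z _; rewrite normrM ler_wpM2l//.
rewrite ler_wpM2r// ?exprn_ge0 ?sumr_ge0//; first by move=> u _; rewrite sumr_ge0.
rewrite [leRHS](bigD1 x)//= lerDl sumr_ge0// => u _; exact: sumr_ge0.
Qed.

(** In this form a generator annihilates constants, so that only the flips
    matter in the powers below. *)
Lemma generator_app alpha (g : cube n -> R) x :
  \sum_z generator alpha x z * g z =
  \sum_(i < n) rate alpha i x * (g (flip i x) - g x).
Proof.
rewrite (bigD1 x) //= /generator eqxx.
under eq_bigr => z /negbTE -> do rewrite mulr_suml.
rewrite (exchange_big_dep predT) //=.
have H i : \sum_(z | (z != x) && (z == flip i x)) rate alpha i x * g z =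
    rate alpha i x * g (flip i x).
  rewrite (eq_bigl (pred1 (flip i x))) ?big_pred1_eq// => z /=.
  by have [->|] := eqVneq z (flip i x); rewrite ?flip_neq ?andbF.
rewrite (eq_bigr _ (fun i _ => H i)).
rewrite mulNr mulr_suml -sumrN -big_split /=; apply: eq_bigr => i _; ring.
Qed.

Lemma generator_pow_eq0 alpha k x y : (k < hamming x y)%N ->
  kernel_pow (generator alpha) k x y = 0.
Proof.
elim: k x => [|k IH] x.
  by rewrite lt0n hamming_eq0 /= => /negbTE ->.
move=> kxy; rewrite /= generator_app big1// => i _.
rewrite !IH ?subrr ?mulr0 //; first exact: ltnW.
have [xy|xy] := eqVneq (x i) (y i); last by move: kxy; rewrite (hamming_flip i).
by rewrite hamming_flipS// ltnW// ltnW.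
Qed.

(** Leading coefficient of the kernel from [x] to [y] as time vanishes: each
    differing coordinate has to jump once. *)
Definition jump_weight alpha x y : R := \prod_(i < n | x i != y i) rate alpha i x.

(** Each of the [d!] orders in which the [d] differing coordinates can be
    flipped contributes the same product of rates, because the rate of a
    coordinate does not depend on the other ones. *)
Lemma generator_pow_hamming alpha x y :
  kernel_pow (generator alpha) (hamming x y) x y =
  (hamming x y)`!%:R * jump_weight alpha x y.
Proof.
move dE : (hamming x y) => d; elim: d x dE => [|d IH] x dE.
  move/eqP: dE; rewrite hamming_eq0 => /eqP ->; rewrite /= eqxx /jump_weight.
  by rewrite big_pred0 ?fact0 ?mulr1// => i; rewrite eqxx.
rewrite [kernel_pow _ _ _ _]/= generator_app.
transitivity (\sum_(i < n | x i != y i) d`!%:R * jump_weight alpha x y); last first.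
  by rewrite sum_diff_const dE -[LHS]mulr_natl mulrA -natrM -factS.
rewrite [RHS]big_mkcond; apply: eq_bigr => i _.
rewrite (generator_pow_eq0 alpha d x y) ?dE// subr0.
case: ifPn => [xy | /negPn/eqP xy]; last first.
  by rewrite generator_pow_eq0 ?mulr0// hamming_flipS// dE ltnW.
rewrite IH; last by move: dE; rewrite (hamming_flip i)// => -[].
rewrite mulrCA; congr (_ * _); rewrite /jump_weight [RHS](bigD1 i)//=.
congr (_ * _); apply: eq_big => [j|j].
  have [->|ji] := eqVneq j i; last by rewrite flip_other// andbT.
  by rewrite flip_same andbF; move: xy; case: (x i); case: (y i).
have [->|ji] := eqVneq j i; last by rewrite /rate flip_other.
by rewrite flip_same; move: xy; case: (x i); case: (y i).
Qed.

End Kernels.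

Section Asymptotics.
Local Open Scope classical_set_scope.
Local Open Scope ring_scope.
Context {R : realType}.

Lemma cvg_exp_series (a : nat -> R) (C : R) :
  0 <= C -> (forall k, `|a k| <= C ^+ k) ->
  cvgn (series (fun k => a k / k`!%:R)).
Proof.
move=> C0 aC.
have uC k : `|a k / k`!%:R| <= exp_coeff C k.
  by rewrite normrM normfV (ger0_norm (ler0n _ _)) ler_wpM2r ?invr_ge0.
apply: normed_cvg; apply: (series_le_cvg _ _ uC).
- by move=> k; exact: normr_ge0.
- by move=> k; exact: exp_coeff_ge0.
- exact: is_cvg_series_exp_coeff.
Qed.

(** For [g <= 1] every term beyond the first nonzero one carries a factor
    [g ^+ d.+1], and what is left is dominated by the series of [expR C]. *)
Lemma exp_series_remainder (a : nat -> R) (C g : R) (d : nat) :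
  0 <= C -> 0 < g <= 1 -> (forall k, `|a k| <= C ^+ k) ->
  (forall k, (k < d)%N -> a k = 0) ->
  `|limn (series (fun k => g ^+ k * a k / k`!%:R)) - g ^+ d * a d / d`!%:R|
    <= g ^+ d.+1 * expR C.
Proof.
move=> C0 /andP[g0 g1] aC a0.
pose u k := g ^+ k * a k / k`!%:R; rewrite -/u -[X in _ - X]/(u d).
have ucvg : cvgn (series u).
  apply: (cvg_exp_series _ C) => // k.
  rewrite normrM normrX (gtr0_norm g0) (le_trans _ (aC k))// ler_piMl//.
  by rewrite exprn_ile1// ltW.
have cvgd : `|series u N - u d| @[N --> \oo] --> `|limn (series u) - u d|.
  by apply: cvg_norm; apply: cvgB => //; exact: cvg_cst.
rewrite -(cvg_lim _ cvgd)//; apply: limr_le; first by apply/cvg_ex; eexists; exact: cvgd.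
exists d.+1 => // N /= dN.
rewrite /series /= (@big_cat_nat _ _ _ d)//= ?(ltnW dN)//.
rewrite big_nat big1 ?add0r; last by move=> k kd; rewrite /u a0 ?mulr0 ?mul0r.
rewrite (@big_cat_nat _ _ _ d.+1)//= big_nat1 [u d + _]addrC addrK.
apply: (@le_trans _ _ (g ^+ d.+1 * \sum_(d.+1 <= k < N) exp_coeff C k)).
  rewrite mulr_sumr (le_trans (ler_norm_sum _ _ _))// big_nat [leRHS]big_nat.
  apply: ler_sum => k /andP[dk _].
  rewrite /u /exp_coeff/= normrM normfV (ger0_norm (ler0n _ _)) normrM normrX (gtr0_norm g0).
  rewrite mulrA ler_wpM2r ?invr_ge0//; apply: ler_pM => //.
    by rewrite exprn_ge0// ltW.
  by rewrite ler_wiXn2l// ltW.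
apply: ler_wpM2l; first by rewrite exprn_ge0// ltW.
apply: (@le_trans _ _ (series (exp_coeff C) N)); last first.
  apply: nondecreasing_cvgn_le; last exact: is_cvg_series_exp_coeff.
  by apply: nondecreasing_series => k _ _; exact: exp_coeff_ge0.
rewrite /series /= [leRHS](@big_cat_nat _ _ _ d.+1)//= lerDr.
by apply: sumr_ge0 => k _; exact: exp_coeff_ge0.
Qed.

Context {n : nat}.
Implicit Types (alpha : 'I_n -> R) (x y z : cube n).

Lemma semigroup_asymptotics alpha x y :
  semigroup alpha g 1 x y / g ^+ hamming x y @[g --> 0^'+]
    --> jump_weight alpha x y.
Proof.
have [C C0 HC] := kernel_pow_le (generator alpha).
set d := hamming x y.
have rem g : 0 < g <= 1 ->
    `|semigroup alpha g 1 x y / g ^+ d - jump_weight alpha x y| <= g * expR C.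
  move=> g01; have g0 : 0 < g by case/andP: g01.
  have := exp_series_remainder (fun k => kernel_pow (generator alpha) k x y) C g d
    C0 g01 (fun k => HC k x y) (fun k kd => generator_pow_eq0 alpha k x y kd).
  rewrite generator_pow_hamming -/d => H.
  have -> : semigroup alpha g 1 x y = limn (series (fun k =>
      g ^+ k * kernel_pow (generator alpha) k x y / k`!%:R)).
    rewrite /semigroup /kernel_exp; congr (limn (series _)); apply/funext => k.
    by rewrite kernel_powZ mulr1.
  have gd : 0 < g ^+ d by rewrite exprn_gt0.
  rewrite -(ler_pM2l gd) -{1}(gtr0_norm gd) -normrM mulrBr mulrCA divff ?gt_eqF// mulr1.
  rewrite mulrA -exprSr; congr (`|_ - _| <= _): H.
  have : d`!%:R != 0 :> R by rewrite pnatr_eq0 -lt0n fact_gt0.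
  move=> ?; field => //.
apply/cvgrPdist_le => e e0; near=> g.
rewrite distrC (le_trans (rem g _))//; first by apply/andP; split; near: g; [exact: nbhs_right_gt | exact: nbhs_right_le].
rewrite -ler_pdivlMr ?expR_gt0//; near: g; apply: nbhs_right_le.
by rewrite divr_gt0 ?expR_gt0.
Unshelve. all: by end_near. Qed.

Lemma cvg_kernel_exp (A : cube n -> cube n -> R) x y :
  cvgn (series (fun k => kernel_pow A k x y / k`!%:R)).
Proof.
have [C C0 HC] := kernel_pow_le A.
exact: (cvg_exp_series (fun k => kernel_pow A k x y) C).
Qed.

(** Detailed balance passes to powers, hence to the exponential. *)
Lemma kernel_exp_reversible (m : cube n -> R) (A : cube n -> cube n -> R) x y :
  (forall u v, m u * A u v = m v * A v u) ->
  m x * kernel_exp A x y = m y * kernel_exp A y x.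
Proof.
move=> H; have cv u v : m u * series (fun k => kernel_pow A k u v / k`!%:R) N
    @[N --> \oo] --> m u * kernel_exp A u v.
  by apply: cvgM; [exact: cvg_cst | exact: cvg_kernel_exp].
rewrite -(cvg_lim _ (cv x y))// -(cvg_lim _ (cv y x))//; congr (limn _).
apply/funext => N; rewrite /series /= !mulr_sumr; apply: eq_bigr => k _.
by rewrite !mulrA; congr (_ / _); exact: kernel_pow_reversible.
Qed.

Lemma product_measure_flip alpha i z :
  product_measure alpha z * rate alpha i z =
  product_measure alpha (flip i z) * rate alpha i (flip i z).
Proof.
rewrite /product_measure (bigD1 i)//= [in RHS](bigD1 i)//= /rate !flip_same.
rewrite [in RHS](eq_bigr (fun j => if z j then alpha j else 1 - alpha j)).
  by case: (z i) => /=; ring.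
by move=> j ji; rewrite flip_other.
Qed.

Lemma generator_reversible alpha x y :
  product_measure alpha x * generator alpha x y =
  product_measure alpha y * generator alpha y x.
Proof.
rewrite /generator; have [->//|yx] := eqVneq y x.
rewrite !mulr_sumr.
apply: eq_big => [i|i /eqP ->]; last by rewrite product_measure_flip.
by apply/eqP/eqP => ->; rewrite flipK.
Qed.

End Asymptotics.

(** * The zero-temperature coupling *)

Section ZeroTemperature.
Local Open Scope classical_set_scope.
Local Open Scope ring_scope.
Context {R : realType} {n : nat}.
Variable alpha : 'I_n -> R.
Hypothesis halpha : forall i, 0 < alpha i < 1.
Implicit Types (x y z : cube n).

Let mu := product_measure alpha.

Lemma product_measure_gt0 x : 0 < mu x.
Proof.
apply: prodr_gt0 => i _; have /andP[a0 a1] := halpha i.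
by case: (x i) => //; rewrite subr_gt0.
Qed.

Lemma jump_weight_gt0 x y : 0 < jump_weight alpha x y.
Proof.
apply: prodr_gt0 => i _; have /andP[a0 a1] := halpha i.
by rewrite /rate; case: (x i) => /=; lra.
Qed.

Section Positive.
Variables (nu0 nu1 : cube n -> R) (gamma : R) (p : cube n -> cube n -> R).
Hypothesis hp : schrodinger_coupling alpha nu0 nu1 gamma p.
Let P := semigroup alpha gamma 1.

Lemma schrodinger_marginals :
  (forall x, \sum_y p x y = nu0 x) /\ (forall y, \sum_x p x y = nu1 y).
Proof.
have [f [g [_ Hf Hg Hp]]] := hp; split=> [x|y].
  transitivity (mu x * (f x * kernel_app P g x)).
    rewrite !mulr_sumr; apply: eq_bigr => y _; rewrite Hp -/mu -/P; ring.
  by rewrite Hf mulrC divfK// gt_eqF// product_measure_gt0.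
transitivity (mu y * (g y * kernel_app P f y)).
  rewrite !mulr_sumr; apply: eq_bigr => x _; rewrite Hp -/mu -/P.
  rewrite /mu /P /semigroup (kernel_exp_reversible mu); first by rewrite /mu; ring.
  by move=> u v; rewrite mulrCA generator_reversible mulrCA.
by rewrite Hg mulrC divfK// gt_eqF// product_measure_gt0.
Qed.

Lemma schrodinger_ge0 x y : 0 <= P x y -> 0 <= p x y.
Proof.
have [f [g [[f0 g0] _ _ ->]]] := hp => P0.
by rewrite !mulr_ge0// ltW// product_measure_gt0.
Qed.

(** The factors [f] and [g] occur once for each of the four points, whichever
    way the points are paired. *)
Lemma schrodinger_exchange x x' y y' :
  P x y' * P x' y * (p x y * p x' y') = P x y * P x' y' * (p x y' * p x' y).
Proof. by have [f [g [_ _ _ Hp]]] := hp; rewrite !Hp -/P; ring. Qed.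

End Positive.

Section Limit.
Variables (nu0 nu1 : cube n -> R) (p : cube n -> cube n -> R).
Hypothesis hp : zero_temperature_coupling alpha nu0 nu1 p.

Lemma zero_temperature_is_coupling : is_coupling nu0 nu1 p.
Proof.
have [pi_ [Hpi cvpi]] := hp.
have gt0_near : \forall g \near (0:R)^'+, 0 < g by exact: nbhs_right_gt.
split=> [x y|x|y].
- rewrite -(cvg_lim _ (cvpi x y))//; apply: limr_ge.
    by apply/cvg_ex; eexists; exact: cvpi.
  have P_near := cvgr_gt _ (semigroup_asymptotics alpha x y) _ (jump_weight_gt0 x y).
  apply: filterS2 gt0_near (P_near _) => g g0 Pg; apply: (schrodinger_ge0 _ _ _ _ (Hpi g g0)).
  by move: Pg; rewrite pmulr_lgt0 ?invr_gt0 ?exprn_gt0// => /ltW.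
- have cv : \sum_y pi_ g x y @[g --> 0^'+] --> \sum_y p x y.
    by apply: cvg_big => [|y _]; [exact: add_continuous|exact: cvpi].
  rewrite -(cvg_lim _ cv)//; apply: lim_near_cst => //.
  by apply: filterS gt0_near => g g0; exact: (schrodinger_marginals _ _ _ _ (Hpi g g0)).1.
- have cv : \sum_x pi_ g x y @[g --> 0^'+] --> \sum_x p x y.
    by apply: cvg_big => [|x _]; [exact: add_continuous|exact: cvpi].
  rewrite -(cvg_lim _ cv)//; apply: lim_near_cst => //.
  by apply: filterS gt0_near => g g0; exact: (schrodinger_marginals _ _ _ _ (Hpi g g0)).2.
Qed.

(** Dividing [schrodinger_exchange] by the smaller power [gamma ^+ D1] and
    letting [gamma] vanish leaves the leading coefficients; the right-hand side
    survives only if the two pairings have the same total length. *)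
Lemma zero_temperature_exchange x x' y y' :
  let D1 := (hamming x y' + hamming x' y)%N in
  let D2 := (hamming x y + hamming x' y')%N in
  (D1 <= D2)%N ->
  jump_weight alpha x y' * jump_weight alpha x' y * (p x y * p x' y') =
  0 ^+ (D2 - D1) *
    (jump_weight alpha x y * jump_weight alpha x' y' * (p x y' * p x' y)).
Proof.
move=> D1 D2 D12; have [pi_ [Hpi cvpi]] := hp.
pose Phi g u v := semigroup alpha g 1 u v / g ^+ hamming u v.
have cvPhi u v : Phi g u v @[g --> 0^'+] --> jump_weight alpha u v.
  exact: semigroup_asymptotics.
have cvL : Phi g x y' * Phi g x' y * (pi_ g x y * pi_ g x' y') @[g --> 0^'+] -->
    jump_weight alpha x y' * jump_weight alpha x' y * (p x y * p x' y').
  by apply: cvgM; apply: cvgM.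
have cvR : g ^+ (D2 - D1) * (Phi g x y * Phi g x' y' * (pi_ g x y' * pi_ g x' y))
    @[g --> 0^'+] --> 0 ^+ (D2 - D1) *
    (jump_weight alpha x y * jump_weight alpha x' y' * (p x y' * p x' y)).
  apply: cvgM; last by apply: cvgM; apply: cvgM.
  by apply: cvg_at_right_filter; exact: exprn_continuous.
rewrite -(cvg_lim _ cvL)//; apply: cvg_lim => //; apply: cvg_trans cvR.
apply: near_eq_cvg; near=> g.
have g0 : 0 < g by near: g; exact: nbhs_right_gt.
have := schrodinger_exchange _ _ _ _ (Hpi g g0) x x' y y'.
rewrite /Phi; set P := semigroup alpha g 1 => H.
have gx u v : g ^+ hamming u v != 0 by rewrite expf_neq0// gt_eqF.
have PE u v : P u v = P u v / g ^+ hamming u v * g ^+ hamming u v by rewrite divfK.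
have gE : g ^+ hamming x y * g ^+ hamming x' y' =
    g ^+ (D2 - D1) * (g ^+ hamming x y' * g ^+ hamming x' y).
  by rewrite -!exprD subnK.
apply/esym; apply: (@mulIf _ (g ^+ hamming x y' * g ^+ hamming x' y)); first by rewrite mulf_neq0.
rewrite (PE x y') (PE x' y) (PE x y) (PE x' y') in H.
rewrite [LHS](_ : _ = P x y' / g ^+ hamming x y' * g ^+ hamming x y' *
  (P x' y / g ^+ hamming x' y * g ^+ hamming x' y) *
  (pi_ g x y * pi_ g x' y')); last by ring.
rewrite H [LHS](_ : _ = P x y / g ^+ hamming x y * (P x' y' / g ^+ hamming x' y') *
  (pi_ g x y' * pi_ g x' y) * (g ^+ hamming x y * g ^+ hamming x' y')); last by ring.
by rewrite gE; ring.
Unshelve. all: by end_near. Qed.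

(** Coordinatewise: [z i] is an end point of each of the four pairs, so that
    exchanging the targets keeps the number of flips of [i] and the values from
    which they start. *)
Lemma jump_weight_exchange x x' y y' z :
  z \in segment x y -> z \in segment x' y' ->
  z \in segment x y' -> z \in segment x' y ->
  jump_weight alpha x y' * jump_weight alpha x' y =
  jump_weight alpha x y * jump_weight alpha x' y'.
Proof.
rewrite !segmentE => /forallP h1 /forallP h2 /forallP h3 /forallP h4.
have E u v : jump_weight alpha u v =
    \prod_i (if u i != v i then rate alpha i u else 1) by exact: big_mkcond.
rewrite !E -!big_split; apply: eq_bigr => i _ /=.
move: (h1 i) (h2 i) (h3 i) (h4 i); rewrite /rate.
by case: (x i); case: (y i); case: (z i); case: (x' i); case: (y' i) => //= *; ring.
Qed.

(** For the weights [q x y * bridge_kernel t x y z] this means that, at any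
    time, the start and the target are independent given the present position
    [z]. In particular, if two charged segments meet at [z], following the first
    one up to [z] and then the second one is again a geodesic. *)
Definition memoryless (q : cube n -> cube n -> R) := forall x x' y y' z,
  z \in segment x y -> z \in segment x' y' ->
  q x y * q x' y' =
    ((z \in segment x y') && (z \in segment x' y))%:R * (q x y' * q x' y).

(** By the triangle inequality at [z], exchanging the targets does not increase
    the total length. If it decreases it, the limit [zero_temperature_exchange]
    is zero, otherwise its coefficients agree by [jump_weight_exchange]. *)
Lemma zero_temperature_memoryless : memoryless p.
Proof.
move=> x x' y y' z h1 h2; have /= := zero_temperature_exchange x x' y y'.
have [W1 W2] := (jump_weight_gt0 x y', jump_weight_gt0 x' y).
have t1 := hamming_triangle x y' z; have t2 := hamming_triangle x' y z.
have s1 := segment_hamming _ _ _ h1; have s2 := segment_hamming _ _ _ h2.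
have [/andP[h3 h4] | h34] := boolP (_ && _).
  rewrite (jump_weight_exchange _ _ _ _ _ h1 h2 h3 h4).
  have s3 := segment_hamming _ _ _ h3; have s4 := segment_hamming _ _ _ h4.
  have -> : (hamming x y' + hamming x' y = hamming x y + hamming x' y')%N by lia.
  rewrite leqnn subnn.
  move=> /(_ isT); rewrite expr0 !mul1r; apply: mulfI.
  by rewrite mulf_neq0// gt_eqF// jump_weight_gt0.
rewrite mul0r.
have D12 : (hamming x y' + hamming x' y < hamming x y + hamming x' y')%N.
  move: h34; rewrite negb_and !inE; lia.
move=> /(_ (ltnW D12)); rewrite expr0n subn_eq0 leqNgt D12 mul0r.
by rewrite -[RHS](mulr0 (jump_weight alpha x y' * jump_weight alpha x' y));
  apply: mulfI; rewrite mulf_neq0// gt_eqF.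
Qed.

End Limit.
End ZeroTemperature.

(** * Convexity gaps *)

Section ConvexityGap.
Local Open Scope classical_set_scope.
Local Open Scope ring_scope.
Context {R : realType}.
Implicit Types (f g : R -> R) (s t : R).

Definition gap f t : R := (1 - t) * f 0 + t * f 1 - f t.

(** Derivatives are required inside the interval only: the slope of an entropy
    may be infinite at the end points, where continuity suffices. *)
Definition second_derivative f f2 : Prop :=
  continuous f /\ exists f1, forall s, 0 < s < 1 ->
    is_derive s 1 f (f1 s) /\ is_derive s 1 f1 (f2 s).

(** The slopes of the chords of [f - g] on both sides of [t] are values of its
    derivative, which is nondecreasing. *)
Lemma gap_le f g f2 g2 t : 0 < t < 1 ->
  second_derivative f f2 -> second_derivative g g2 ->
  (forall s, 0 < s < 1 -> g2 s <= f2 s) -> gap g t <= gap f t.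
Proof.
move=> /andP[t0 t1] [cf [f1 Hf]] [cg [g1 Hg]] fg.
pose k := f - g; pose k1 s := f1 s - g1 s; pose k2 s := f2 s - g2 s.
have ck (a b : R) : {within `[a, b], continuous k}.
  by apply: continuous_subspaceT => x; apply: cvgB; [exact: cf | exact: cg].
have dk s : 0 < s < 1 -> is_derive s 1 k (k1 s).
  by move=> s01; have [? _] := Hf s s01; have [? _] := Hg s s01; exact: is_deriveB.
have dk1 s : 0 < s < 1 -> is_derive s 1 k1 (k2 s).
  by move=> s01; have [_ ?] := Hf s s01; have [_ ?] := Hg s s01; exact: is_deriveB.
have k1_mono c d : 0 < c -> c < d -> d < 1 -> k1 c <= k1 d.
  move=> c0 cd d1.
  have in01 s : s \in `[c, d] -> 0 < s < 1.
    by rewrite in_itv/= => /andP[? ?]; apply/andP; split; lra.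
  have dk1cd s : s \in `]c, d[ -> is_derive s 1 k1 (k2 s).
    by move=> /subset_itv_oo_cc/in01; exact: dk1.
  have ck1 : {within `[c, d], continuous k1}.
    by apply: derivable_within_continuous => s /in01/dk1 ?; exact: ex_derive.
  have [e ecd] := MVT cd dk1cd ck1.
  rewrite -subr_ge0 => ->; rewrite mulr_ge0 ?subr_ge0 ?(ltW cd)// fg//.
  exact/in01/subset_itv_oo_cc.
have dk0 s : s \in `]0, t[ -> is_derive s 1 k (k1 s).
  by rewrite in_itv/= => /andP[? ?]; apply: dk; apply/andP; split; lra.
have dk' s : s \in `]t, 1[ -> is_derive s 1 k (k1 s).
  by rewrite in_itv/= => /andP[? ?]; apply: dk; apply/andP; split; lra.
have [c] := MVT t0 dk0 (ck 0 t); have [d] := MVT t1 dk' (ck t 1).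
rewrite !in_itv/= => /andP[td d1] Hd /andP[c0 ct] Hc.
have Hd' : f 1 - g 1 - (f t - g t) = k1 d * (1 - t) by exact: Hd.
have Hc' : f t - g t - (f 0 - g 0) = k1 c * (t - 0) by exact: Hc.
rewrite -subr_ge0 /gap (_ : _ - _ = t * (f 1 - g 1 - (f t - g t)) -
  (1 - t) * (f t - g t - (f 0 - g 0))); last by ring.
rewrite Hd' Hc' (_ : _ - _ = t * (1 - t) * (k1 d - k1 c)); last by ring.
have kcd : k1 c <= k1 d by apply: k1_mono => //; exact: lt_trans td.
by rewrite !mulr_ge0 ?subr_ge0// ltW.
Qed.

Lemma is_derive_continuous f s df : is_derive s 1 f df -> {for s, continuous f}.
Proof. by move=> H; apply/differentiable_continuous/derivable1_diffP/ex_derive. Qed.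

Lemma continuous_xlnx : continuous (fun x : R => x * ln x).
Proof.
move=> x; have [x0|x0] := ltP 0 x.
  by apply: continuousM; [exact: cvg_id | exact: continuous_ln].
rewrite /continuous_at; have -> : x * ln x = 0 by rewrite (ln0 x0) mulr0.
apply/cvgrPdist_le => e e0.
have e2 : 0 < (e / 2) ^+ 2 by rewrite exprn_gt0// divr_gt0.
near=> y; rewrite sub0r normrN; have [y0|y0] := leP y 0; first by rewrite (ln0 y0) mulr0 normr0 ltW.
(* With [r] the square root of [y], [ln r^-1 <= r^-1] yields
   [- y * ln y <= 2 * r]. *)
pose r := Num.sqrt y; have r0 : 0 < r by rewrite sqrtr_gt0.
have yr : y = r * r by rewrite -expr2 sqr_sqrtr// ltW.
have y1 : y <= 1.
  near: y; exact: (cvgr_le _ cvg_id _ (le_lt_trans x0 ltr01)).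
have ye : y <= (e / 2) ^+ 2.
  near: y; exact: (cvgr_le _ cvg_id _ (le_lt_trans x0 e2)).
have re : r <= e / 2.
  rewrite -(@ler_pXn2r _ 2)// ?nnegrE; [|exact: ltW|by rewrite divr_ge0// ltW].
  by rewrite expr2 -yr.
rewrite ler0_norm; last by rewrite mulr_ge0_le0 ?ln_le0// ltW.
have : ln r^-1 <= r^-1.
  by apply/ltW/ln_sublinear; rewrite invr_gt0.
rewrite lnV ?posrE// => H.
rewrite yr lnM ?posrE//.
have := ler_wpM2l (ltW (mulr_gt0 r0 r0)) H.
rewrite mulfK ?gt_eqF// => H2; lra.
Unshelve. all: by end_near. Qed.

Lemma second_derivative_poly (q : {poly R}) :
  second_derivative (horner q) (horner q^`()^`()).
Proof.
split; last by exists (horner q^`()) => s _; split; exact: is_derive_poly.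
by move=> s; apply: is_derive_continuous; exact: is_derive_poly.
Qed.

Lemma second_derivative_xlnx (q : {poly R}) :
  (forall s, 0 < s < 1 -> 0 < q.[s]) ->
  second_derivative (fun s => q.[s] * ln q.[s])
    (fun s => q^`()^`().[s] * (ln q.[s] + 1) + q^`().[s] ^+ 2 / q.[s]).
Proof.
move=> q0; split.
  move=> s; apply: (@continuous_comp _ _ _ (horner q) (fun x => x * ln x)).
    by have [c _] := second_derivative_poly q; exact: c.
  exact: continuous_xlnx.
exists (fun s => q^`().[s] * (ln q.[s] + 1)) => s /q0 qs.
have dq (p : {poly R}) := is_derive_poly p s.
have dln : is_derive s 1 (fun s => ln q.[s]) (q.[s]^-1 * q^`().[s]).
  by apply: is_derive1_comp; exact: is_derive1_ln.
have q0' : q.[s] != 0 by rewrite gt_eqF.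
split.
  have := @is_deriveM _ _ _ _ _ _ _ _ (dq q) dln.
  have E : q.[s] * (q.[s]^-1 * q^`().[s]) + ln q.[s] * q^`().[s] =
    q^`().[s] * (ln q.[s] + 1) by field.
  by move/is_derive_eq; apply; exact: E.
have dln1 := @is_deriveD _ _ _ _ _ _ _ _ _ dln (is_derive_cst (1 : R) s 1).
have := @is_deriveM _ _ _ _ _ _ _ _ (dq q^`()) dln1.
have E : q^`().[s] * (q.[s]^-1 * q^`().[s] + 0) + (ln q.[s] + 1) * q^`()^`().[s] =
  q^`()^`().[s] * (ln q.[s] + 1) + q^`().[s] ^+ 2 / q.[s] by field.
by move/is_derive_eq; apply; exact: E.
Qed.

Lemma second_derivative0 : second_derivative (fun=> 0 : R) (fun=> 0).
Proof.
split; first by move=> x; exact: cvg_cst.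
by exists (fun=> 0) => s _; split; exact: is_derive_cst.
Qed.

Lemma second_derivativeD f f2 g g2 :
  second_derivative f f2 -> second_derivative g g2 ->
  second_derivative (fun s => f s + g s) (fun s => f2 s + g2 s).
Proof.
move=> [cf [f1 Hf]] [cg [g1 Hg]]; split; first by move=> x; apply: cvgD; [exact: cf|exact: cg].
exists (fun s => f1 s + g1 s) => s s01.
by have [? ?] := Hf s s01; have [? ?] := Hg s s01; split; exact: is_deriveD.
Qed.

Lemma second_derivativeZ (c : R) f f2 :
  second_derivative f f2 -> second_derivative (fun s => c * f s) (fun s => c * f2 s).
Proof.
move=> [cf [f1 Hf]]; split; first by move=> x; apply: cvgM; [exact: cvg_cst|exact: cf].
exists (fun s => c * f1 s) => s s01.
by have [? ?] := Hf s s01; split; exact: is_deriveZ.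
Qed.

Lemma second_derivative_sum (I : Type) (r : seq I) (P : pred I) (f f2 : I -> R -> R) :
  (forall i, P i -> second_derivative (f i) (f2 i)) ->
  second_derivative (fun s => \sum_(i <- r | P i) f i s)
                    (fun s => \sum_(i <- r | P i) f2 i s).
Proof.
move=> H; elim: r => [|i r IH].
  have E (F : I -> R -> R) : (fun s => \sum_(i <- [::] | P i) F i s) = fun=> 0.
    by apply/funext => s; rewrite big_nil.
  by rewrite !E; exact: second_derivative0.
have E (F : I -> R -> R) : (fun s => \sum_(j <- i :: r | P j) F j s) =
    fun s => (P i)%:R * F i s + \sum_(j <- r | P j) F j s.
  by apply/funext => s; rewrite big_cons; case: ifP; rewrite ?mul1r// mul0r add0r.
rewrite !E; apply: second_derivativeD => //.
have [Pi|_] := boolP (P i); first by apply: second_derivativeZ; exact: H.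
have E0 (F : I -> R -> R) : (fun s => false%:R * F i s) = fun=> 0.
  by apply/funext => s; rewrite mul0r.
by rewrite !E0; exact: second_derivative0.
Qed.

Lemma gapD f g t : gap (fun s => f s + g s) t = gap f t + gap g t.
Proof. by rewrite /gap; ring. Qed.

Lemma gapZ (c : R) f t : gap (fun s => c * f s) t = c * gap f t.
Proof. by rewrite /gap; ring. Qed.

Lemma gap_sum (I : Type) (r : seq I) (P : pred I) (f : I -> R -> R) t :
  gap (fun s => \sum_(i <- r | P i) f i s) t = \sum_(i <- r | P i) gap (f i) t.
Proof. by rewrite /gap !mulr_sumr -big_split /= -sumrB. Qed.

End ConvexityGap.

(** * Moments of the bridge between two points *)

Section BridgeKernel.
Context {R : realType} {n : nat}.
Implicit Types (t : R) (x y z : cube n) (i j : 'I_n).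

Lemma bridge_kernel_prod t x y z :
  bridge_kernel t x y z =
  \prod_i (((z i == x i) || (z i == y i))%:R *
           t ^+ (x i != z i) * (1 - t) ^+ (z i != y i)).
Proof.
rewrite !big_split /= -!expr_sum /bridge_kernel -!/(hamming _ _) segmentE.
congr (_ * _ * _); case: forallP => [H|/forallP/forallPn[i /negbTE H]].
  by rewrite big1// => i _; rewrite H.
by rewrite (bigD1 i)//= H mul0r.
Qed.

Lemma bridge_kernel_ge0 t x y z : 0 < t < 1 -> 0 <= bridge_kernel t x y z.
Proof.
move=> /andP[t0 t1]; rewrite /bridge_kernel !mulr_ge0 ?exprn_ge0//; lra.
Qed.

Lemma bridge_kernelC t x y z : bridge_kernel t x y z = bridge_kernel (1 - t) y x z.
Proof.
rewrite /bridge_kernel subKr [hamming x z]hammingC [hamming z y]hammingC segmentC.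
by rewrite mulrAC.
Qed.

Lemma bridge_kernel_sum t x y : \sum_z bridge_kernel t x y z = 1.
Proof.
under eq_bigr do rewrite bridge_kernel_prod.
pose F i (b : bool) : R := ((b == x i) || (b == y i))%:R *
  t ^+ (x i != b) * (1 - t) ^+ (b != y i).
transitivity (\prod_i \sum_(b : bool) F i b); first by rewrite bigA_distr_bigA.
rewrite big1// => i _; rewrite /F big_bool; case: (x i); case: (y i) => /=; ring.
Qed.

Lemma bridge_kernel_diff t x y z i :
  bridge_kernel t x y z * ((z i != y i)%:R + (x i != z i)%:R) =
  bridge_kernel t x y z * (x i != y i)%:R.
Proof.
rewrite /bridge_kernel; have [|_] := boolP (z \in _); last by rewrite !mul0r.
rewrite segmentE => /forallP/(_ i).
by case: (x i); case: (y i); case: (z i) => //= _; rewrite ?addr0 ?add0r.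
Qed.

Lemma bridge_kernel_excl t x y z i :
  bridge_kernel t x y z * ((z i != y i)%:R * (x i != z i)%:R) = 0.
Proof.
rewrite /bridge_kernel; have [|_] := boolP (z \in _); last by rewrite !mul0r.
rewrite segmentE => /forallP/(_ i).
by case: (x i); case: (y i); case: (z i) => //= _; rewrite !(mul0r, mulr0).
Qed.

(** Flux balance along an edge: the chain leaves [z] through coordinate [i]
    exactly as often as it is found just after such a jump. *)
Lemma bridge_kernel_flip t x y z i :
  t * (bridge_kernel t x y z * (z i != y i)%:R) =
  (1 - t) * (bridge_kernel t x y (flip i z) * (x i != flip i z i)%:R).
Proof.
rewrite !bridge_kernel_prod (bigD1 i)//= [in RHS](bigD1 i)//= flip_same.
rewrite [in RHS](eq_bigr (fun j => ((z j == x j) || (z j == y j))%:R *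
           t ^+ (x j != z j) * (1 - t) ^+ (z j != y j))).
  by case: (x i); case: (y i); case: (z i) => /=; ring.
by move=> j ji; rewrite flip_other.
Qed.

(** By [bridge_kernel_flip] the mass still to flip [i] and the mass having
    flipped it are in the ratio [1 - t : t], and they add up to the mass of the
    bridge if [x] and [y] differ at [i]. *)
Lemma bridge_moment_up t x y i (G : cube n -> R) :
  (forall z, G (flip i z) = G z) ->
  \sum_z bridge_kernel t x y z * ((z i != y i)%:R * G z) =
  (1 - t) * ((x i != y i)%:R * \sum_z bridge_kernel t x y z * G z).
Proof.
move=> HG; set U := LHS.
pose D := \sum_z bridge_kernel t x y z * ((x i != z i)%:R * G z).
have UD : t * U = (1 - t) * D.
  rewrite /D -(sum_flip _ i) !mulr_sumr; apply: eq_bigr => z _.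
  rewrite HG [LHS](_ : _ = t * (bridge_kernel t x y z * (z i != y i)%:R) * G z).
    by rewrite bridge_kernel_flip; ring.
  by ring.
have -> : (x i != y i)%:R * \sum_z bridge_kernel t x y z * G z = U + D.
  rewrite -big_split mulr_sumr; apply: eq_bigr => z _ /=.
  transitivity (bridge_kernel t x y z * (x i != y i)%:R * G z); first by ring.
  by rewrite -bridge_kernel_diff; ring.
by rewrite mulrDr -UD; ring.
Qed.

Lemma bridge_moment_down t x y i (G : cube n -> R) :
  (forall z, G (flip i z) = G z) ->
  \sum_z bridge_kernel t x y z * ((x i != z i)%:R * G z) =
  t * ((x i != y i)%:R * \sum_z bridge_kernel t x y z * G z).
Proof.
move=> HG; under eq_bigr do rewrite bridge_kernelC [x i == _]eq_sym.
rewrite bridge_moment_up// subKr [x i == _]eq_sym; congr (_ * (_ * _)).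
by apply: eq_bigr => z _; rewrite bridge_kernelC subKr.
Qed.

Lemma bridge_moment_up1 t x y i :
  \sum_z bridge_kernel t x y z * (z i != y i)%:R = (1 - t) * (x i != y i)%:R.
Proof.
under eq_bigr do rewrite -[_%:R]mulr1.
rewrite bridge_moment_up//; under eq_bigr do rewrite mulr1.
by rewrite bridge_kernel_sum mulr1.
Qed.

Lemma bridge_moment_down1 t x y i :
  \sum_z bridge_kernel t x y z * (x i != z i)%:R = t * (x i != y i)%:R.
Proof.
under eq_bigr do rewrite -[_%:R]mulr1.
rewrite bridge_moment_down//; under eq_bigr do rewrite mulr1.
by rewrite bridge_kernel_sum mulr1.
Qed.

(** The bridge takes [z i] from [y] with probability [t] and from [x] otherwise. *)
Lemma bridge_affine t x y (l : 'I_n -> bool -> R) :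
  \sum_z bridge_kernel t x y z * (\sum_i l i (z i)) =
  (1 - t) * (\sum_i l i (x i)) + t * (\sum_i l i (y i)).
Proof.
under eq_bigr do rewrite mulr_sumr.
rewrite exchange_big /= !mulr_sumr -big_split /=; apply: eq_bigr => i _.
transitivity (\sum_z (bridge_kernel t x y z * l i (x i) +
   (l i (y i) - l i (x i)) * (bridge_kernel t x y z * ((x i != z i)%:R * 1)))).
  apply: eq_bigr => z _; rewrite /bridge_kernel.
  have [|_] := boolP (z \in _); last by rewrite !mul0r mulr0 addr0.
  rewrite segmentE => /forallP/(_ i).
  by case: (x i); case: (y i); case: (z i) => //= _; ring.
rewrite big_split /= -mulr_suml bridge_kernel_sum -mulr_sumr bridge_moment_down//.
under eq_bigr do rewrite mulr1.
rewrite bridge_kernel_sum; case: (x i); case: (y i) => /=; ring.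
Qed.

Lemma sum_pairs_bool (e : 'I_n -> bool) (S := (\sum_i e i)%N) :
  \sum_i \sum_(j | j != i) (e i)%:R * (e j)%:R = (S * S.-1)%:R :> R.
Proof.
transitivity (\sum_i (e i)%:R * S.-1%:R : R); last first.
  by rewrite -mulr_suml natrM /S natr_sum.
apply: eq_bigr => i _; rewrite -mulr_sumr.
case ei: (e i); last by rewrite !mul0r.
by rewrite /S [in RHS](bigD1 i)//= ei add1n /= natr_sum mul1r.
Qed.

Lemma bridge_moments t x y (N := hamming x y) :
  [/\ \sum_z bridge_kernel t x y z * (hamming z y * (hamming z y).-1)%:R =
        (1 - t) ^+ 2 * (N * N.-1)%:R,
      \sum_z bridge_kernel t x y z * (hamming x z * (hamming x z).-1)%:R =
        t ^+ 2 * (N * N.-1)%:R &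
      \sum_z bridge_kernel t x y z * (hamming x z * hamming z y)%:R =
        t * (1 - t) * (N * N.-1)%:R].
Proof.
have NE : (N * N.-1)%:R =
    \sum_i \sum_(j | j != i) (x i != y i)%:R * (x j != y j)%:R :> R.
  by rewrite sum_pairs_bool.
have mom (c : R) (F : 'I_n -> 'I_n -> cube n -> R) :
    (forall i j, j != i -> \sum_z bridge_kernel t x y z * F i j z =
       c * ((x i != y i)%:R * (x j != y j)%:R)) ->
    \sum_z bridge_kernel t x y z * (\sum_i \sum_(j | j != i) F i j z) =
    c * (N * N.-1)%:R.
  move=> HF; rewrite NE mulr_sumr; under eq_bigr do rewrite mulr_sumr.
  rewrite exchange_big /=; apply: eq_bigr => i _.
  under eq_bigr do rewrite mulr_sumr.
  rewrite exchange_big mulr_sumr /=; apply: eq_bigr => j ji; exact: HF.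
split.
- under eq_bigr do rewrite /hamming -sum_pairs_bool.
  apply: mom => i j ji; rewrite bridge_moment_up; last by move=> z; rewrite flip_other.
  by rewrite bridge_moment_up1; ring.
- under eq_bigr do rewrite /hamming -sum_pairs_bool.
  apply: mom => i j ji; rewrite bridge_moment_down; last by move=> z; rewrite flip_other.
  by rewrite bridge_moment_down1; ring.
- transitivity (\sum_z bridge_kernel t x y z *
     (\sum_i \sum_(j | j != i) (x i != z i)%:R * (z j != y j)%:R)).
    apply: eq_bigr => z _; rewrite natrM /hamming !natr_sum mulr_suml.
    rewrite [LHS]mulr_sumr [RHS]mulr_sumr; apply: eq_bigr => i _.
    rewrite (bigD1 i)//= mulrDr mulrDr -mulr_sumr [X in _ * X + _]mulrC.
    by rewrite bridge_kernel_excl add0r.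
  apply: mom => i j ji; rewrite bridge_moment_down; last by move=> z; rewrite flip_other.
  by rewrite bridge_moment_up1; ring.
Qed.

End BridgeKernel.

(** * Relative entropy against squared rates *)

Section Excess.
Context {R : realType}.
Implicit Types (c d k : R).

(** Relative entropy of a mass [c] with respect to a mass [d]. *)
Definition excess c d : R := c * ln (c / d) - c + d.

Lemma le_1V_ln k : 0 < k -> 1 - k^-1 <= ln k.
Proof.
move=> k0; have kV : 0 < k^-1 by rewrite invr_gt0.
have := @le_ln1Dx R (k^-1 - 1); rewrite [1 + _]addrC subrK lnV// => H.
have /H : -1 < k^-1 - 1 by lra.
by lra.
Qed.

(** Legendre duality of the relative entropy, with [ln k] as dual variable. *)
Lemma excess_ge c d k : 0 < k -> 0 <= c -> 0 <= d -> (c != 0 -> d != 0) ->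
  c * ln k - (k - 1) * d <= excess c d.
Proof.
move=> k0 c0 d0 cd; rewrite /excess; have [c00|cN0] := eqVneq c 0.
  have := mulr_ge0 (ltW k0) d0; rewrite c00 !mul0r; lra.
have cp : 0 < c by rewrite lt0r cN0.
have dp : 0 < d by rewrite lt0r cd.
have := le_1V_ln (c / d / k); rewrite !divr_gt0// => /(_ isT).
rewrite ln_div ?posrE ?divr_gt0// !invf_div => H.
have := ler_wpM2l c0 H; have -> : c * (1 - k * (d / c)) = c - k * d by field.
lra.
Qed.

Lemma excess_ge0 c d : 0 <= c -> 0 <= d -> (c != 0 -> d != 0) -> 0 <= excess c d.
Proof.
move=> c0 d0 cd; have := excess_ge c d 1 ltr01 c0 d0 cd.
by rewrite ln1 subrr mulr0 mul0r subr0.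
Qed.

Context {n : nat}.
Implicit Types (a : 'I_n -> R) (S : {set 'I_n}).

(** Cauchy-Schwarz against the indicator of [S]. *)
Lemma sqr_sum_le a S : (forall i, a i != 0 -> i \in S) ->
  (\sum_i a i) ^+ 2 <= #|S|%:R * \sum_i a i ^+ 2.
Proof.
move=> aS; have [S0|S0] := posnP #|S|.
  rewrite big1 ?expr0n ?mulr_ge0//=; first by apply: sumr_ge0 => i _; exact: sqr_ge0.
  move=> i _; apply/eqP/negPn/negP => /aS.
  by rewrite (cards0_eq S0) inE.
have p0 : 0 < #|S|%:R :> R by rewrite ltr0n.
pose m := (\sum_i a i) / #|S|%:R.
have : 0 <= \sum_i (a i - m * (i \in S)%:R) ^+ 2.
  by apply: sumr_ge0 => i _; exact: sqr_ge0.
have -> : \sum_i (a i - m * (i \in S)%:R) ^+ 2 =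
    \sum_i (a i ^+ 2 - 2 * m * a i + m ^+ 2 * (i \in S)%:R).
  apply: eq_bigr => i _; have := aS i; case: (i \in S) => /=; first by move=> _; ring.
  by have [->|_ /(_ isT)] := eqVneq (a i) 0 => // _; ring.
have -> : \sum_i (a i ^+ 2 - 2 * m * a i + m ^+ 2 * (i \in S)%:R) =
    \sum_i a i ^+ 2 - 2 * m * \sum_i a i + m ^+ 2 * #|S|%:R.
  rewrite big_split /= sumrB -!mulr_sumr -natr_sum -sum1_card.
  by congr (_ + _ * _%:R); rewrite [RHS]big_mkcond; apply: eq_bigr => i _; case: ifP.
move=> H; rewrite -subr_ge0; have := mulr_ge0 (ltW p0) H; congr (_ <= _).
by rewrite /m; field; rewrite gt_eqF.
Qed.

(** If [p] of the rates [a i] are nonzero, the products [a i * a j] over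
    distinct indices add up to at most [p - 1] times the sum of the squares. In
    the duality bound [excess_ge] with [k = p / (p - 1)] the squares therefore
    absorb the products, and [ln k >= 1 / p] is left in front of [aa]. *)
Lemma squares_excess_ge a (aa : 'I_n -> 'I_n -> R) (q : R) :
  0 <= q -> (forall i, 0 <= a i) -> (forall i j, 0 <= aa i j) ->
  (forall i j, aa i j != 0 -> [/\ a i != 0, a j != 0 & q != 0]) ->
  #|[set i | a i != 0]|%:R^-1 * (\sum_i \sum_(j | j != i) aa i j) <=
  \sum_i a i ^+ 2 / q + \sum_i \sum_(j | j != i) excess (aa i j) (a i * a j / q).
Proof.
move=> q0 a0 aa0 aaN0; set S := [set i | _]; set p := #|S|.
have d0 i j : 0 <= a i * a j / q by rewrite divr_ge0// mulr_ge0.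
have cd i j : aa i j != 0 -> a i * a j / q != 0.
  by move=> /aaN0[ai aj qn]; rewrite !mulf_neq0 ?invr_eq0.
(* A nonzero [aa i j] requires two nonzero rates. *)
have [p1|p1] := leqP p 1.
  rewrite big1 ?mulr0; last first.
    move=> i _; apply: big1 => j ji; apply/eqP/negPn/negP => /aaN0[ai aj _].
    have : (#|[set i; j]| <= p)%N.
      by apply/subset_leq_card/fintype.subsetP => k; rewrite in_set2 => /orP[] /eqP ->; rewrite inE.
    by rewrite cards2 eq_sym ji leqNgt ltnS p1.
  rewrite addr_ge0// sumr_ge0// => i _; first by rewrite divr_ge0// sqr_ge0.
  by rewrite sumr_ge0// => j ji; apply: excess_ge0 => //; exact: cd.
have pR : 1 < p%:R :> R by rewrite ltr1n.
pose k : R := p%:R / (p%:R - 1).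
have k0 : 0 < k by rewrite divr_gt0 ?subr_gt0// (lt_trans ltr01).
have lnk : p%:R^-1 <= ln k.
  apply: le_trans (le_1V_ln k k0); rewrite /k invf_div le_eqVlt; apply/orP; left; apply/eqP.
  by field; lra.
have lower : \sum_i \sum_(j | j != i) (aa i j * ln k - (k - 1) * (a i * a j / q)) <=
    \sum_i \sum_(j | j != i) excess (aa i j) (a i * a j / q).
  apply: ler_sum => i _; apply: ler_sum => j ji; apply: excess_ge => //; exact: cd.
have pairs : \sum_i \sum_(j | j != i) a i * a j / q =
    ((\sum_i a i) ^+ 2 - \sum_i a i ^+ 2) / q.
  rewrite expr2 mulr_suml -sumrB mulr_suml; apply: eq_bigr => i _.
  rewrite -mulr_suml -mulr_sumr; congr (_ / _).
  by rewrite [X in _ = _ * X - _](bigD1 i)//=; ring.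
have cs : (\sum_i a i) ^+ 2 / q <= p%:R * (\sum_i a i ^+ 2) / q.
  rewrite ler_wpM2r ?invr_ge0//; apply: sqr_sum_le => i; by rewrite inE.
have split : \sum_i \sum_(j | j != i) (aa i j * ln k - (k - 1) * (a i * a j / q)) =
    (\sum_i \sum_(j | j != i) aa i j) * ln k -
    (k - 1) * (\sum_i \sum_(j | j != i) a i * a j / q).
  rewrite mulr_suml mulr_sumr -sumrB; apply: eq_bigr => i _.
  by rewrite mulr_suml mulr_sumr -sumrB.
rewrite split pairs in lower.
have AA0 : 0 <= \sum_i \sum_(j | j != i) aa i j.
  by apply: sumr_ge0 => i _; apply: sumr_ge0.
have H1 := ler_wpM2l AA0 lnk.
have k1 : k - 1 = (p%:R - 1)^-1 by rewrite /k; field; lra.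
have H2 : (k - 1) * (((\sum_i a i) ^+ 2 - \sum_i a i ^+ 2) / q) <= \sum_i a i ^+ 2 / q.
  rewrite k1 mulrC ler_pdivrMr ?subr_gt0// -[X in _ <= X * _]mulr_suml.
  rewrite !mulrBl in cs *; lra.
rewrite [leLHS]mulrC; apply: le_trans H1 _; move: lower H2; lra.
Qed.

Lemma squares_excess_ge_squares a (aa : 'I_n -> 'I_n -> R) (q : R) :
  0 <= q -> (forall i, 0 <= a i) -> (forall i j, 0 <= aa i j) ->
  (forall i j, aa i j != 0 -> [/\ a i != 0, a j != 0 & q != 0]) ->
  \sum_i a i ^+ 2 / q <=
  \sum_i a i ^+ 2 / q + \sum_i \sum_(j | j != i) excess (aa i j) (a i * a j / q).
Proof.
move=> q0 a0 aa0 aaN0; rewrite lerDl; apply: sumr_ge0 => i _; apply: sumr_ge0 => j ji.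
apply: excess_ge0 => //; first by rewrite divr_ge0// mulr_ge0.
by move=> /aaN0[ai aj qn]; rewrite !mulf_neq0 ?invr_eq0.
Qed.

End Excess.

(** * Fluxes of a memoryless bridge *)

Section Fluxes.
Context {R : realType} {n : nat}.
Variables (p : cube n -> cube n -> R) (t : R).
Implicit Types (x y z : cube n) (i j : 'I_n) (F G : cube n -> cube n -> R).

Definition bridge_mean F z : R := \sum_x \sum_y p x y * bridge_kernel t x y z * F x y.

(** Masses per unit time. A bridge still to flip [i] does so at rate
    [1 / (1 - t)] and, run backwards, undoes its flip of [i] at rate [1 / t].
    The second-order fluxes are those through two edges: both leaving [z], both
    leading to [z], or leading to [z] through [j] and leaving it through [i]. *)
Definition flux_out i z : R := bridge_mean (fun _ y => (z i != y i)%:R) z / (1 - t).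
Definition flux_in i z : R := bridge_mean (fun x _ => (x i != z i)%:R) z / t.
Definition flux_out2 i j z : R :=
  bridge_mean (fun _ y => (z i != y i)%:R * (z j != y j)%:R) z / (1 - t) ^+ 2.
Definition flux_in2 i j z : R :=
  bridge_mean (fun x _ => (x i != z i)%:R * (x j != z j)%:R) z / t ^+ 2.
Definition flux_through i j z : R :=
  bridge_mean (fun x y => (x j != z j)%:R * (z i != y i)%:R) z / (t * (1 - t)).

Lemma bridge_meanE z : bridge p t z = bridge_mean (fun _ _ => 1) z.
Proof.
by apply: eq_bigr => x _; apply: eq_bigr => y _; rewrite mulr1 mulrC.
Qed.

Lemma eq_bridge_mean F G z :
  (forall x y, bridge_kernel t x y z * F x y = bridge_kernel t x y z * G x y) ->
  bridge_mean F z = bridge_mean G z.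
Proof.
by move=> H; apply: eq_bigr => x _; apply: eq_bigr => y _; rewrite -mulrA H mulrA.
Qed.

Lemma bridge_meanZ (c : R) F z :
  bridge_mean (fun x y => c * F x y) z = c * bridge_mean F z.
Proof.
rewrite mulr_sumr; apply: eq_bigr => x _; rewrite mulr_sumr.
by apply: eq_bigr => y _; ring.
Qed.

Lemma bridge_mean_sum (I : Type) (r : seq I) (P : pred I) (F : I -> cube n -> cube n -> R) z :
  bridge_mean (fun x y => \sum_(i <- r | P i) F i x y) z =
  \sum_(i <- r | P i) bridge_mean (F i) z.
Proof.
rewrite exchange_big /=; apply: eq_bigr => x _; rewrite exchange_big /=.
by apply: eq_bigr => y _; rewrite mulr_sumr.
Qed.

Lemma bridge_mean0 z : bridge_mean (fun _ _ => 0) z = 0.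
Proof. by rewrite /bridge_mean big1// => x _; rewrite big1// => y _; rewrite mulr0. Qed.

Lemma flux_out2C i j z : flux_out2 i j z = flux_out2 j i z.
Proof. by congr (_ / _); apply: eq_bridge_mean => x y; congr (_ * _); exact: mulrC. Qed.

Hypothesis ht : 0 < t < 1.

Let t_neq0 : t != 0. Proof. by case/andP: ht => ? _; rewrite gt_eqF. Qed.
Let t1_neq0 : 1 - t != 0. Proof. by case/andP: ht => _ ?; rewrite gt_eqF// subr_gt0. Qed.

(** Flux balance of [bridge_kernel_flip] under the coupling. *)
Lemma bridge_mean_flip i F z (G := fun x y => (z i != y i)%:R * F x y) :
  bridge_mean G z / (1 - t) =
  bridge_mean (fun x y => (x i != flip i z i)%:R * F x y) (flip i z) / t.
Proof.
rewrite !mulr_suml; apply: eq_bigr => x _; rewrite !mulr_suml; apply: eq_bigr => y _.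
have := bridge_kernel_flip t x y z i.
set u := (_ != _)%:R; set d := (_ != _)%:R => H.
rewrite /G -/u; apply: (@mulfI _ (t * (1 - t))); first by rewrite mulf_neq0.
transitivity (p x y * F x y * (t * (bridge_kernel t x y z * u))); first by field.
by rewrite H; field.
Qed.

Lemma flux_out_flip i z : flux_out i z = flux_in i (flip i z).
Proof.
rewrite /flux_out /flux_in.
rewrite (eq_bridge_mean _ (fun _ y => (z i != y i)%:R * 1)); last by move=> x y; rewrite mulr1.
rewrite bridge_mean_flip; congr (_ / _).
by apply: eq_bridge_mean => x y; rewrite mulr1.
Qed.

Lemma flux_out2_flip i j z : i != j -> flux_out2 i j z = flux_through i j (flip j z).
Proof.
move=> ij; transitivity
    (bridge_mean (fun _ y => (z j != y j)%:R * (z i != y i)%:R) z / (1 - t) / (1 - t)).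
  rewrite -[RHS]mulrA -invfM -expr2; congr (_ / _).
  by apply: eq_bridge_mean => x y; rewrite [X in _ * X]mulrC.
by rewrite bridge_mean_flip /flux_through invfM [RHS]mulrA [flip j z i]flip_other.
Qed.

Lemma flux_through_flip i j z : i != j -> flux_through i j z = flux_in2 i j (flip i z).
Proof.
move=> ij; transitivity
    (bridge_mean (fun x y => (z i != y i)%:R * (x j != z j)%:R) z / (1 - t) / t).
  rewrite -[RHS]mulrA -invfM [(1 - t) * _]mulrC; congr (_ / _).
  by apply: eq_bridge_mean => x y; rewrite [X in _ * X]mulrC.
rewrite bridge_mean_flip /flux_in2 expr2 invfM [RHS]mulrA.
by rewrite [flip i z j]flip_other// eq_sym.
Qed.

Lemma flux_through_diag i z : flux_through i i z = 0.
Proof.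
rewrite /flux_through (_ : bridge_mean _ z = 0) ?mul0r// -(bridge_mean0 z).
by apply: eq_bridge_mean => x y; rewrite mulr0 [X in _ * X]mulrC bridge_kernel_excl.
Qed.

Hypothesis p_ge0 : forall x y, 0 <= p x y.

Lemma bridge_weight_ge0 x y z : 0 <= p x y * bridge_kernel t x y z.
Proof. by rewrite mulr_ge0// bridge_kernel_ge0. Qed.

Lemma bridge_mean_ge0 F z : (forall x y, 0 <= F x y) -> 0 <= bridge_mean F z.
Proof.
by move=> F0; do 2!apply: sumr_ge0 => ? _; rewrite mulr_ge0// bridge_weight_ge0.
Qed.

Lemma bridge_mean_eq0P F z : (forall x y, 0 <= F x y) -> bridge_mean F z = 0 ->
  forall x y, p x y * bridge_kernel t x y z * F x y = 0.
Proof.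
move=> F0 H x y.
have W0 u v : 0 <= p u v * bridge_kernel t u v z * F u v.
  by rewrite mulr_ge0// bridge_weight_ge0.
move: H => /psumr_eq0P H.
have /psumr_eq0P Hx := H (fun u _ => sumr_ge0 _ (fun v _ => W0 u v)) x isT.
exact: Hx (fun v _ => W0 x v) y isT.
Qed.

Lemma bridge_mean_eq0 F G z : (forall x y, 0 <= F x y) ->
  bridge_mean F z = 0 -> bridge_mean (fun x y => F x y * G x y) z = 0.
Proof.
move=> F0 H; rewrite /bridge_mean big1// => x _; rewrite big1// => y _.
by rewrite mulrA (bridge_mean_eq0P F z F0 H) mul0r.
Qed.

Lemma bridge_ge0 z : 0 <= bridge p t z.
Proof. by rewrite bridge_meanE bridge_mean_ge0. Qed.

Lemma bridge_mean_null F z : bridge p t z = 0 -> bridge_mean F z = 0.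
Proof.
rewrite bridge_meanE => /(bridge_mean_eq0 _ F _ (fun _ _ => ler01)) <-.
by apply: eq_bridge_mean => x y; rewrite mul1r.
Qed.

Lemma flux_out_ge0 i z : 0 <= flux_out i z.
Proof.
by rewrite divr_ge0 ?bridge_mean_ge0// subr_ge0 ltW//; case/andP: ht.
Qed.

Lemma flux_out2_ge0 i j z : 0 <= flux_out2 i j z.
Proof. by rewrite divr_ge0 ?sqr_ge0// bridge_mean_ge0// => x y; rewrite mulr_ge0. Qed.

Lemma flux_in_ge0 i z : 0 <= flux_in i z.
Proof.
by rewrite divr_ge0 ?bridge_mean_ge0// ltW//; case/andP: ht.
Qed.

Lemma flux_in2_ge0 i j z : 0 <= flux_in2 i j z.
Proof. by rewrite divr_ge0 ?sqr_ge0// bridge_mean_ge0// => x y; rewrite mulr_ge0. Qed.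

Lemma flux_out2_neq0 i j z : flux_out2 i j z != 0 ->
  [/\ flux_out i z != 0, flux_out j z != 0 & bridge p t z != 0].
Proof.
move=> H; split; apply: contraNneq H.
- move=> /eqP; rewrite mulf_eq0 invr_eq0 (negbTE t1_neq0) orbF => /eqP H.
  by rewrite /flux_out2 bridge_mean_eq0 ?mul0r.
- move=> /eqP; rewrite flux_out2C mulf_eq0 invr_eq0 (negbTE t1_neq0) orbF => /eqP H.
  by rewrite /flux_out2 bridge_mean_eq0 ?mul0r.
- by move=> H; rewrite /flux_out2 bridge_mean_null ?mul0r.
Qed.

Lemma flux_in2_neq0 i j z : flux_in2 i j z != 0 ->
  [/\ flux_in i z != 0, flux_in j z != 0 & bridge p t z != 0].
Proof.
move=> H; split; apply: contraNneq H.
- move=> /eqP; rewrite mulf_eq0 invr_eq0 (negbTE t_neq0) orbF => /eqP H.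
  by rewrite /flux_in2 bridge_mean_eq0 ?mul0r.
- move=> /eqP; rewrite mulf_eq0 invr_eq0 (negbTE t_neq0) orbF => /eqP H.
  rewrite /flux_in2 (_ : bridge_mean _ z = 0) ?mul0r//.
  rewrite -[RHS](bridge_mean_eq0 _ (fun x _ => (x i != z i)%:R) _ _ H)//.
  by apply: eq_bridge_mean => x y; congr (_ * _); exact: mulrC.
- by move=> H; rewrite /flux_in2 bridge_mean_null ?mul0r.
Qed.

Hypothesis p_memoryless : memoryless p.

Lemma memoryless_weights x x' y y' z :
  (p x y * bridge_kernel t x y z) * (p x' y' * bridge_kernel t x' y' z) =
  (p x y' * bridge_kernel t x y' z) * (p x' y * bridge_kernel t x' y z).
Proof.
rewrite /bridge_kernel.
have [h1|h1] := boolP (z \in segment x y); have [h2|h2] := boolP (z \in segment x' y').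
- by rewrite mulrACA (p_memoryless x x' y y' z)//; case: (_ \in _); case: (_ \in _) => /=; ring.
all: have [h3|_] := boolP (z \in segment x y'); have [h4|_] := boolP (z \in segment x' y);
  rewrite /= ?(mul0r, mulr0)//;
  rewrite [RHS]mulrACA (p_memoryless x x' y' y z)// ?(negbTE h1) ?(negbTE h2) ?andbF/=;
  by rewrite !mul0r.
Qed.

(** Both sides are sums over two bridges meeting at [z], and exchanging their
    targets maps one to the other. *)
Lemma bridge_mean_indep (f g : cube n -> R) z :
  bridge_mean (fun x y => f x * g y) z * bridge p t z =
  bridge_mean (fun x _ => f x) z * bridge_mean (fun _ y => g y) z.
Proof.
rewrite bridge_meanE /bridge_mean !pair_bigA /= !big_distrlr /=.
rewrite !pair_bigA /=.
rewrite (reindex_inj (h := fun u : (cube n * cube n) * (cube n * cube n) =>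
  ((u.1.1, u.2.2), (u.2.1, u.1.2)))) /=; last first.
  by move=> [[a b] [c d]] [[a' b'] [c' d']] [-> -> -> ->].
apply: eq_bigr => -[[a b] [c d]] _ /=; have := memoryless_weights a c d b z => H.
rewrite mulr1 [LHS](_ : _ = p a d * bridge_kernel t a d z *
  (p c b * bridge_kernel t c b z) * (f a * g d)); last by ring.
rewrite H; ring.
Qed.

Lemma flux_through_indep i j z :
  flux_through i j z * bridge p t z = flux_out i z * flux_in j z.
Proof.
rewrite /flux_through mulrAC
  (bridge_mean_indep (fun x => (x j != z j)%:R) (fun y => (z i != y i)%:R)).
by rewrite /flux_out /flux_in; field; apply/andP.
Qed.

(** No bridge flips [i] twice, so that by independence those which have flipped
    [i] never meet those which have yet to flip it. *)
Lemma flux_out_in i z : flux_out i z * flux_in i z = 0.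
Proof. by rewrite -flux_through_indep flux_through_diag mul0r. Qed.

End Fluxes.

(** * Second variation of the entropy *)

Section SecondVariation.
Context {R : realType} {n : nat}.
Variables (p : cube n -> cube n -> R) (t : R).
Hypothesis ht : 0 < t < 1.
Hypothesis p_ge0 : forall x y, 0 <= p x y.
Hypothesis p_memoryless : memoryless p.
Implicit Types (x y z : cube n) (i j : 'I_n).

Local Notation Q := (bridge p t).
Local Notation out := (flux_out p t).
Local Notation inn := (flux_in p t).
Local Notation out2 := (flux_out2 p t).
Local Notation in2 := (flux_in2 p t).
Local Notation through := (flux_through p t).

(** Time derivatives of [Q z], as balances over the edges and the squares of the
    cube that contain [z]. *)
Definition bridge_d1 z : R := \sum_i (inn i z - out i z).
Definition bridge_d2 z : R :=
  \sum_i \sum_(j | j != i) (out2 i j z + in2 i j z - through i j z - through j i z).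

(** The forward rates at [z] are [out i z / Q z], and [out2] is compared with its
    value if a jump through [j] did not change the rate of [i]. *)
Definition action_out z : R :=
  \sum_i out i z ^+ 2 / Q z +
  \sum_i \sum_(j | j != i) excess (out2 i j z) (out i z * out j z / Q z).
Definition action_in z : R :=
  \sum_i inn i z ^+ 2 / Q z +
  \sum_i \sum_(j | j != i) excess (in2 i j z) (inn i z * inn j z / Q z).

Lemma out2_in2 i j z : i != j -> out2 i j z = in2 i j (flip i (flip j z)).
Proof. by move=> ij; rewrite flux_out2_flip// flux_through_flip. Qed.

(** Independence at the two intermediate vertices of the square from [z] to [w]
    expresses their masses by the fluxes at [z] and [w]. *)
Lemma log_ratio_split i j z (w := flip i (flip j z)) : i != j ->
  out2 i j z * (ln (Q z) + ln (Q w) - ln (Q (flip i z)) - ln (Q (flip j z))) =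
  out2 i j z * ln (out2 i j z / (out i z * out j z / Q z)) +
  out2 i j z * ln (in2 i j w / (inn i w * inn j w / Q w)).
Proof.
move=> ij; have [->|oN0] := eqVneq (out2 i j z) 0; first by rewrite !mul0r addr0.
have [oi oj q0] := flux_out2_neq0 p t ht p_ge0 i j z oN0.
have wE : out2 i j z = in2 i j w by exact: out2_in2.
have [ii ij' qw] : [/\ inn i w != 0, inn j w != 0 & Q w != 0].
  by apply: flux_in2_neq0 => //; rewrite -wE.
have gt0 (u : R) : 0 <= u -> u != 0 -> 0 < u by move=> u0 uN; rewrite lt0r uN.
have kj : out2 i j z * Q (flip j z) = inn i w * out j z.
  rewrite flux_out2_flip// flux_through_indep// flux_out_flip//.
  by rewrite [out j z]flux_out_flip.
have ki : out2 i j z * Q (flip i z) = inn j w * out i z.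
  rewrite flux_out2C flux_out2_flip 1?eq_sym// flux_through_indep// flux_out_flip//.
  by rewrite [out i z]flux_out_flip// flipC.
have qi : Q (flip i z) != 0.
  by move: (mulf_neq0 ij' oi); rewrite -ki mulf_eq0 negb_or => /andP[].
have qj : Q (flip j z) != 0.
  by move: (mulf_neq0 ii oj); rewrite -kj mulf_eq0 negb_or => /andP[].
rewrite -wE -mulrDr; congr (_ * _).
have o2 : 0 < out2 i j z by rewrite gt0// flux_out2_ge0.
have poi : 0 < out i z by rewrite gt0// flux_out_ge0.
have poj : 0 < out j z by rewrite gt0// flux_out_ge0.
have pii : 0 < inn i w by rewrite gt0// flux_in_ge0.
have pij : 0 < inn j w by rewrite gt0// flux_in_ge0.
have pq : 0 < Q z by rewrite gt0// bridge_ge0.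
have pw : 0 < Q w by rewrite gt0// bridge_ge0.
have pqi : 0 < Q (flip i z) by rewrite gt0// bridge_ge0.
have pqj : 0 < Q (flip j z) by rewrite gt0// bridge_ge0.
have L : 0 < out2 i j z / (out i z * out j z / Q z).
  exact: divr_gt0 o2 (divr_gt0 (mulr_gt0 poi poj) pq).
have M : 0 < out2 i j z / (inn i w * inn j w / Q w).
  exact: divr_gt0 o2 (divr_gt0 (mulr_gt0 pii pij) pw).
have N : 0 < Q z * Q w by rewrite mulr_gt0.
have lnMp (u v : R) : 0 < u -> 0 < v -> ln (u * v) = ln u + ln v.
  by move=> u0 v0; rewrite lnM ?posrE.
have lnDp (u v : R) : 0 < u -> 0 < v -> ln (u / v) = ln u - ln v.
  by move=> u0 v0; rewrite ln_div ?posrE.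
rewrite -(lnMp _ _ pq pw) -(lnDp _ _ N pqi) -(lnDp _ _ (divr_gt0 N pqi) pqj) -(lnMp _ _ L M).
congr ln.
rewrite [RHS](_ : _ = out2 i j z ^+ 2 * Q z * Q w /
    ((inn j w * out i z) * (inn i w * out j z))); last by field; do ?[apply/andP; split].
rewrite -ki -kj; field; do ?[apply/andP; split] => //.
Qed.

Let sum_flip2 i j (F : cube n -> R) : \sum_z F (flip i (flip j z)) = \sum_z F z.
Proof. by rewrite (sum_flip _ j (fun z => F (flip i z))) sum_flip. Qed.

Lemma sum_flux_through i j : i != j -> \sum_z through i j z = \sum_z out2 i j z.
Proof.
by move=> ij; rewrite -(sum_flip _ j); apply: eq_bigr => z _; rewrite -flux_out2_flip.
Qed.

Lemma sum_flux_in2 i j : i != j -> \sum_z in2 i j z = \sum_z out2 i j z.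
Proof.
by move=> ij; rewrite -(sum_flip2 i j); apply: eq_bigr => z _; rewrite -out2_in2.
Qed.

Lemma sum_bridge_d2 : \sum_z bridge_d2 z = 0.
Proof.
rewrite exchange_big big1// => i _; rewrite exchange_big big1//= => j ji.
rewrite !sumrB big_split /= sum_flux_in2 1?eq_sym// !sum_flux_through// 1?eq_sym//.
rewrite [X in _ - X](eq_bigr (out2 i j)); last by move=> z _; exact: flux_out2C.
by rewrite addrK subrr.
Qed.

(** All second-order fluxes are those of [out2] seen from the four vertices of a
    square, so that flips of the summation variable bring the logarithms into
    the form of [log_ratio_split]. The mixed products [out * inn] yield exactly
    the linear terms of [excess]. *)
Lemma second_variation_pair i j : i != j ->
  \sum_z ((out2 i j z + in2 i j z - through i j z - through j i z) * ln (Q z) +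
          (inn i z - out i z) * (inn j z - out j z) / Q z) =
  \sum_z (excess (out2 i j z) (out i z * out j z / Q z) +
          excess (in2 i j z) (inn i z * inn j z / Q z)).
Proof.
move=> ij; have ji : j != i by rewrite eq_sym.
have thr k l : k != l -> forall F : cube n -> R,
    \sum_z through k l z * F z = \sum_z out2 k l z * F (flip l z).
  by move=> kl F; rewrite -(sum_flip _ l); apply: eq_bigr => z _; rewrite -flux_out2_flip.
have inn2 (F : cube n -> R) : \sum_z in2 i j z * F z = \sum_z out2 i j z * F (flip i (flip j z)).
  by rewrite -(sum_flip2 i j); apply: eq_bigr => z _; rewrite -out2_in2.
have logs : \sum_z (out2 i j z + in2 i j z - through i j z - through j i z) * ln (Q z) =
    \sum_z out2 i j z * ln (out2 i j z / (out i z * out j z / Q z)) +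
    \sum_z in2 i j z * ln (in2 i j z / (inn i z * inn j z / Q z)).
  rewrite inn2 -big_split /=.
  rewrite -[RHS](eq_bigr _ (fun z _ => log_ratio_split i j z ij)).
  under eq_bigr do rewrite !mulrBl mulrDl.
  rewrite !sumrB big_split /= inn2 (thr i j)// (thr j i)//.
  rewrite [RHS](_ : _ = \sum_z (out2 i j z * ln (Q z) +
     out2 i j z * ln (Q (flip i (flip j z))) - out2 i j z * ln (Q (flip j z)) -
     out2 i j z * ln (Q (flip i z)))); last by apply: eq_bigr => z _; ring.
  rewrite !sumrB big_split /=; congr (_ - _).
  by apply: eq_bigr => z _; rewrite flux_out2C.
have quads : \sum_z (inn i z - out i z) * (inn j z - out j z) / Q z =
    \sum_z (out i z * out j z / Q z + inn i z * inn j z / Q z) -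
    \sum_z (out2 i j z + in2 i j z).
  have thrQ k l z : out k z * inn l z / Q z = through k l z.
    rewrite -flux_through_indep//; have [q0|q0] := eqVneq (Q z) 0; last by rewrite mulfK.
    by rewrite q0 invr0 mulr0 /flux_through bridge_mean_null// mul0r.
  have t2 : \sum_z in2 i j z = \sum_z through j i z.
    by rewrite sum_flux_in2// sum_flux_through//; apply: eq_bigr => z _; rewrite flux_out2C.
  rewrite [X in _ = _ - X]big_split /= -sum_flux_through// t2 -big_split -sumrB /=.
  by apply: eq_bigr => z _; rewrite -!thrQ; ring.
rewrite big_split /= logs quads /excess !big_split /= !sumrN; ring.
Qed.

(** The left-hand side is the second time derivative of the entropy relative to
    the counting measure. Diagonal terms only contain squares, because
    [out i z * inn i z = 0]. *)
Lemma second_variation :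
  \sum_z (bridge_d2 z * ln (Q z) + bridge_d1 z ^+ 2 / Q z) =
  \sum_z (action_out z + action_in z).
Proof.
have d1 z : bridge_d1 z ^+ 2 / Q z =
   \sum_i (out i z ^+ 2 + inn i z ^+ 2) / Q z +
   \sum_i \sum_(j | j != i) (inn i z - out i z) * (inn j z - out j z) / Q z.
  rewrite expr2 big_distrlr mulr_suml -big_split /=; apply: eq_bigr => i _.
  rewrite (bigD1 i)//= mulrDl -mulr_suml; congr (_ / _ + _).
  have := flux_out_in p t ht p_memoryless i z.
  by move=> H; rewrite -expr2 sqrrB [inn i z * _]mulrC H mul0rn subr0 addrC.
transitivity (\sum_z \sum_i (out i z ^+ 2 + inn i z ^+ 2) / Q z +
  \sum_i \sum_(j | j != i) \sum_z
   ((out2 i j z + in2 i j z - through i j z - through j i z) * ln (Q z) +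
          (inn i z - out i z) * (inn j z - out j z) / Q z)).
  rewrite [X in _ = _ + X](eq_bigr (fun i => \sum_z \sum_(j | j != i)
    ((out2 i j z + in2 i j z - through i j z - through j i z) * ln (Q z) +
          (inn i z - out i z) * (inn j z - out j z) / Q z))); last first.
    by move=> i _; rewrite exchange_big.
  rewrite [X in _ = _ + X]exchange_big -big_split /=; apply: eq_bigr => z _.
  rewrite d1 addrCA; congr (_ + _).
  rewrite /bridge_d2 mulr_suml -big_split /=; apply: eq_bigr => i _.
  by rewrite mulr_suml -big_split.
rewrite (eq_bigr (fun i => \sum_(j | j != i) \sum_z
    (excess (out2 i j z) (out i z * out j z / Q z) +
          excess (in2 i j z) (inn i z * inn j z / Q z)))); last first.
  by move=> i _; apply: eq_bigr => j ji; rewrite second_variation_pair// eq_sym.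
rewrite (eq_bigr (fun i => \sum_z \sum_(j | j != i)
    (excess (out2 i j z) (out i z * out j z / Q z) +
          excess (in2 i j z) (inn i z * inn j z / Q z)))); last first.
  by move=> i _; rewrite exchange_big.
rewrite [X in _ + X]exchange_big -big_split /=; apply: eq_bigr => z _.
rewrite /action_out /action_in addrACA; congr (_ + _); rewrite -big_split /=.
  by apply: eq_bigr => i _; rewrite mulrDl.
by apply: eq_bigr => i _; rewrite big_split.
Qed.

End SecondVariation.

(** * Lower bounds by the transport cost and by the jump probabilities *)

Section LowerBounds.
Context {R : realType} {n : nat}.
Variables (p : cube n -> cube n -> R) (t : R).
Hypothesis ht : 0 < t < 1.
Hypothesis p_ge0 : forall x y, 0 <= p x y.
Hypothesis p_memoryless : memoryless p.
Implicit Types (x y z : cube n) (i j : 'I_n).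

Local Notation Q := (bridge p t).
Local Notation out := (flux_out p t).
Local Notation inn := (flux_in p t).
Local Notation out2 := (flux_out2 p t).
Local Notation in2 := (flux_in2 p t).

Let t_gt0 : 0 < t. Proof. by case/andP: ht. Qed.
Let t1_gt0 : 0 < 1 - t. Proof. by rewrite subr_gt0; case/andP: ht. Qed.
Let t_neq0 : t != 0. Proof. by rewrite gt_eqF. Qed.
Let t1_neq0 : 1 - t != 0. Proof. by rewrite gt_eqF. Qed.

Lemma sum_bridge_mean (F : cube n -> cube n -> cube n -> R) :
  \sum_z bridge_mean p t (F z) z =
  \sum_x \sum_y p x y * \sum_z bridge_kernel t x y z * F z x y.
Proof.
rewrite exchange_big /=; apply: eq_bigr => x _; rewrite exchange_big /=.
by apply: eq_bigr => y _; rewrite mulr_sumr; apply: eq_bigr => z _; rewrite mulrA.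
Qed.

Lemma sum_flux_out i : \sum_z out i z = \sum_x \sum_y p x y * (x i != y i)%:R.
Proof.
rewrite -mulr_suml (sum_bridge_mean (fun z _ y => (z i != y i)%:R)) mulr_suml.
apply: eq_bigr => x _; rewrite mulr_suml; apply: eq_bigr => y _.
by rewrite bridge_moment_up1; field.
Qed.

Lemma sum_flux_in i : \sum_z inn i z = \sum_x \sum_y p x y * (x i != y i)%:R.
Proof.
rewrite -sum_flux_out -[LHS](sum_flip _ i); apply: eq_bigr => z _.
by rewrite [RHS]flux_out_flip.
Qed.

Lemma sum_bridge : \sum_z Q z = \sum_x \sum_y p x y.
Proof.
under eq_bigr do rewrite bridge_meanE.
rewrite (sum_bridge_mean (fun _ _ _ => 1)); apply: eq_bigr => x _.
apply: eq_bigr => y _; under eq_bigr do rewrite mulr1.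
by rewrite bridge_kernel_sum mulr1.
Qed.

Lemma transport_costE : transport_cost p = \sum_(i < n) \sum_z out i z.
Proof.
under eq_bigr do rewrite sum_flux_out.
rewrite exchange_big; apply: eq_bigr => x _; rewrite exchange_big /=.
by apply: eq_bigr => y _; rewrite /hamming natr_sum mulr_suml; apply: eq_bigr => i _; rewrite mulrC.
Qed.

Lemma flux_null i z : Q z = 0 -> out i z = 0 /\ inn i z = 0.
Proof. by move=> q0; rewrite /flux_out /flux_in !bridge_mean_null// !mul0r. Qed.

Lemma action_out_ge : forall z, \sum_i out i z ^+ 2 / Q z <= action_out p t z.
Proof.
move=> z; apply: squares_excess_ge_squares.
- exact: bridge_ge0.
- by move=> i; exact: flux_out_ge0.
- by move=> i j; exact: flux_out2_ge0.
- by move=> i j; exact: flux_out2_neq0.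
Qed.

Lemma action_in_ge : forall z, \sum_i inn i z ^+ 2 / Q z <= action_in p t z.
Proof.
move=> z; apply: squares_excess_ge_squares.
- exact: bridge_ge0.
- by move=> i; exact: flux_in_ge0.
- by move=> i j; exact: flux_in2_ge0.
- by move=> i j; exact: flux_in2_neq0.
Qed.

(** By [flux_out_in] a coordinate with a forward flux at a vertex has no backward
    flux there: this exclusion turns the sum of the forward and backward squares
    into the square of a sum. *)
Lemma second_variation_ge_cost : (0 < n)%N -> \sum_x \sum_y p x y = 1 ->
  4 / n%:R * transport_cost p ^+ 2 <= \sum_z (action_out p t z + action_in p t z).
Proof.
move=> n0 p1; have nR : 0 < n%:R :> R by rewrite ltr0n.
set W := transport_cost p; pose c := 2 * W / n%:R.
(* Tangent inequality for the square at [c], the mean of [(out + inn) / Q]. *)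
have pt i z : 2 * c * (out i z + inn i z) - c ^+ 2 * Q z <=
    out i z ^+ 2 / Q z + inn i z ^+ 2 / Q z.
  have [q0|qN0] := eqVneq (Q z) 0.
    by have [-> ->] := flux_null i z q0; rewrite q0 !(expr0n, mul0r, mulr0, addr0, subr0)/=.
  have q0 : 0 < Q z by rewrite lt0r qN0 bridge_ge0.
  rewrite -mulrDl ler_pdivlMr// -subr_ge0.
  have -> : out i z ^+ 2 + inn i z ^+ 2 = (out i z + inn i z) ^+ 2.
    by rewrite sqrrD flux_out_in// mul0rn addr0.
  have := sqr_ge0 (out i z + inn i z - c * Q z); congr (_ <= _); ring.
have H : \sum_z \sum_i (2 * c * (out i z + inn i z) - c ^+ 2 * Q z) <=
    \sum_z (action_out p t z + action_in p t z).
  apply: ler_sum => z _; apply: le_trans (lerD (action_out_ge z) (action_in_ge z)).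
  by rewrite -big_split /=; apply: ler_sum => i _; exact: pt.
apply: le_trans H; rewrite exchange_big /=.
have E i : \sum_z (2 * c * (out i z + inn i z) - c ^+ 2 * Q z) =
    4 * c * (\sum_z out i z) - c ^+ 2.
  rewrite sumrB -!mulr_sumr big_split /= sum_bridge p1 sum_flux_in -sum_flux_out; ring.
rewrite (eq_bigr _ (fun i _ => E i)) sumrB -mulr_sumr -transport_costE -/W.
rewrite sumr_const card_ord -[_ *+ n]mulr_natl /c le_eqVlt; apply/orP; left; apply/eqP.
by field; rewrite gt_eqF.
Qed.

Section Forward.
Variable nu0 : cube n -> R.
Hypothesis nu0E : forall x, \sum_y p x y = nu0 x.

Let nu0_ge0 x : 0 <= nu0 x. Proof. by rewrite -nu0E sumr_ge0. Qed.

Lemma nu0_Pi_forward i x :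
  nu0 x * Pi_forward nu0 p i x = \sum_y p x y * (x i != y i)%:R.
Proof.
rewrite mulr_sumr; apply: eq_bigr => y _; rewrite /forward_kernel [y i == _]eq_sym.
have [n0|n0] := eqVneq (nu0 x) 0; last by field.
have /psumr_eq0P -> // := etrans (nu0E x) n0.
by rewrite mul0r !mulr0 mul0r.
Qed.

Lemma Pi_forward_ge0 i x : 0 <= Pi_forward nu0 p i x.
Proof. by apply: sumr_ge0 => y _; rewrite mulr_ge0// divr_ge0. Qed.

Lemma Pi_forward_le1 i x : Pi_forward nu0 p i x <= 1.
Proof.
have [n0|n0] := eqVneq (nu0 x) 0.
  rewrite /Pi_forward big1 ?ler01// => y _.
  by rewrite /forward_kernel n0 invr0 !mulr0.
have n0' : 0 < nu0 x by rewrite lt0r n0 nu0_ge0.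
rewrite -(ler_pM2l n0') nu0_Pi_forward mulr1 -nu0E; apply: ler_sum => y _.
by rewrite ler_piMr//; case: (_ != _); rewrite /= ?ler01 ?lexx.
Qed.

Let start_mass x z : R := \sum_y p x y * bridge_kernel t x y z.

Let start_mass_ge0 x z : 0 <= start_mass x z.
Proof. by apply: sumr_ge0 => y _; exact: bridge_weight_ge0. Qed.

Let sum_start_mass z : \sum_x start_mass x z = Q z.
Proof. by apply: eq_bigr => x _; apply: eq_bigr => y _; rewrite mulrC. Qed.

Let start_mass_out i x z : start_mass x z * (out i z / Q z) =
  (\sum_y p x y * bridge_kernel t x y z * (z i != y i)%:R) / (1 - t).
Proof.
have ind := bridge_mean_indep p t p_memoryless (fun u => (u == x)%:R)
  (fun y => (z i != y i)%:R) z.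
have pick (G : cube n -> R) : bridge_mean p t (fun u y => (u == x)%:R * G y) z =
    \sum_y p x y * bridge_kernel t x y z * G y.
  rewrite /bridge_mean (bigD1 x)//= [X in _ + X]big1 ?addr0; last first.
    by move=> u /negbTE ux; rewrite big1// => y _; rewrite ux !(mul0r, mulr0).
  by apply: eq_bigr => y _; rewrite eqxx mul1r.
have massE : bridge_mean p t (fun u _ => (u == x)%:R) z = start_mass x z.
  rewrite (eq_bridge_mean _ _ _ (fun u _ => (u == x)%:R * 1)) ?pick.
    by apply: eq_bigr => y _; rewrite mulr1.
  by move=> u y; rewrite mulr1.
rewrite pick massE in ind; rewrite /flux_out.
have [q0|q0] := eqVneq (Q z) 0; last first.
  apply: (@mulIf _ (Q z)) => //; rewrite [RHS]mulrAC ind; field; exact/andP.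
rewrite q0 invr0 !mulr0; have := bridge_mean_null p t ht p_ge0
  (fun u y => (u == x)%:R * (z i != y i)%:R) z q0.
by rewrite pick => ->; rewrite mul0r.
Qed.

(** Conditionally on the starting point [x], the jump rate through [i] vanishes
    once [i] has been flipped, an event of probability [t * Pi]; Jensen's
    inequality on the complementary event gives [Pi ^+ 2 / (1 - t * Pi)]. *)
Lemma forward_speed_ge :
  \sum_x \sum_(i < n) nu0 x * (Pi_forward nu0 p i x ^+ 2 / (1 - t * Pi_forward nu0 p i x))
  <= \sum_z \sum_i out i z ^+ 2 / Q z.
Proof.
rewrite exchange_big [leRHS]exchange_big /=; apply: ler_sum => i _.
pose P x := Pi_forward nu0 p i x; pose c x := P x / (1 - t * P x).
have P1 x : 0 < 1 - t * P x.
  have := Pi_forward_le1 i x; have := Pi_forward_ge0 i x; rewrite -/(P x) => ? ?.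
  have : t * P x <= t by rewrite ler_piMr// ltW.
  by move: t1_gt0; lra.
(* Tangent inequality for the square at [c x], the mean of the rate given that
   the bridge starts from [x] and has not flipped [i]. *)
have pt z : \sum_x start_mass x z * (z i == x i)%:R * (2 * c x * (out i z / Q z) - c x ^+ 2) <=
    out i z ^+ 2 / Q z.
  have -> : out i z ^+ 2 / Q z = \sum_x start_mass x z * (out i z / Q z) ^+ 2.
    rewrite -mulr_suml sum_start_mass; have [q0|q0] := eqVneq (Q z) 0; last by field.
    by rewrite q0 invr0 !mulr0 mul0r.
  apply: ler_sum => x _; case: (z i == x i); last first.
    by rewrite mulr0 mul0r mulr_ge0// sqr_ge0.
  rewrite mulr1 ler_wpM2l// -subr_ge0.
  by have := sqr_ge0 (out i z / Q z - c x); congr (_ <= _); ring.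
apply: le_trans (ler_sum _ (fun z _ => pt z)).
rewrite [leRHS]exchange_big /=; apply: ler_sum => x _.
have S1 : \sum_z start_mass x z * (z i == x i)%:R = nu0 x * (1 - t * P x).
  have -> : nu0 x * (1 - t * P x) = nu0 x - t * (nu0 x * P x) by ring.
  rewrite nu0_Pi_forward -nu0E mulr_sumr -sumrB.
  under eq_bigr do rewrite mulr_suml.
  rewrite exchange_big /=; apply: eq_bigr => y _.
  transitivity (p x y * (\sum_z (bridge_kernel t x y z -
     bridge_kernel t x y z * (x i != z i)%:R))).
    rewrite mulr_sumr; apply: eq_bigr => z _; rewrite [x i == _]eq_sym.
    by case: (z i == x i) => /=; ring.
  by rewrite sumrB bridge_kernel_sum bridge_moment_down1; ring.
have S2 : \sum_z start_mass x z * (z i == x i)%:R * (out i z / Q z) = nu0 x * P x.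
  rewrite nu0_Pi_forward; under eq_bigr do rewrite mulrAC start_mass_out.
  transitivity (\sum_z (\sum_y p x y * (bridge_kernel t x y z * (z i != y i)%:R)) / (1 - t)).
    apply: eq_bigr => z _; rewrite mulrAC; congr (_ / _); rewrite mulr_suml.
    apply: eq_bigr => y _; have := bridge_kernel_excl t x y z i.
    rewrite [x i == _]eq_sym; case: (z i == x i) => /=; first by move=> _; rewrite mulr1 mulrA.
    by rewrite !mulr1 !mulr0 => ->; rewrite mulr0.
  rewrite -mulr_suml exchange_big /= mulr_suml; apply: eq_bigr => y _.
  by rewrite -mulr_sumr bridge_moment_up1; field.
have -> : \sum_z start_mass x z * (z i == x i)%:R * (2 * c x * (out i z / Q z) - c x ^+ 2) =
    2 * c x * (nu0 x * P x) - c x ^+ 2 * (nu0 x * (1 - t * P x)).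
  rewrite -S1 -S2 !mulr_sumr -sumrB; apply: eq_bigr => z _; ring.
rewrite -/(P x) /c le_eqVlt; apply/orP; left; apply/eqP.
by field; rewrite gt_eqF.
Qed.

End Forward.

End LowerBounds.

Section Reversal.
Context {R : realType} {n : nat}.
Variables (p : cube n -> cube n -> R).
Implicit Types (x y z : cube n) (i : 'I_n).

Lemma memoryless_tr : memoryless p -> memoryless (fun x y => p y x).
Proof.
move=> H x x' y y' z h1 h2; rewrite (H y y' x x' z) 1?segmentC// 1?segmentC//.
by rewrite [z \in segment y x']segmentC [z \in segment y' x]segmentC andbC [p y x' * _]mulrC.
Qed.

Lemma bridge_tr t z : bridge p t z = bridge (fun x y => p y x) (1 - t) z.
Proof.
rewrite /bridge exchange_big /=; apply: eq_bigr => x _; apply: eq_bigr => y _.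
by rewrite bridge_kernelC.
Qed.

Lemma flux_in_tr t i z : flux_in p t i z = flux_out (fun x y => p y x) (1 - t) i z.
Proof.
rewrite /flux_in /flux_out subKr; congr (_ / _); rewrite /bridge_mean exchange_big /=.
apply: eq_bigr => x _; apply: eq_bigr => y _.
by rewrite bridge_kernelC [z i == _]eq_sym.
Qed.

End Reversal.

(** * Lower bound by the distances to both end points *)

Section PairMoments.
Context {R : realType}.

(** With [K] and [L] the distances to the target and to the start of a bridge
    of length [N], this is the mean of [K * (K - 1) / (1 - t) ^+ 2 +
    L * (L - 1) / t ^+ 2 + 2 * K.-1 * L.-1 / (t * (1 - t))]. *)
Definition pair_moment (N : nat) (t : R) : R :=
  4 * (N * N.-1)%:R - 2 * N.-1%:R * \sum_(k < N.-1) (t ^+ k + (1 - t) ^+ k).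

(** Cauchy-Schwarz for two terms with weights [p] and [m]. *)
Lemma weighted_squares_ge (A B c d p m : R) : 0 < p -> 0 < m ->
  c ^+ 2 <= A -> d ^+ 2 <= B -> A + B + 2 * (c * d) <= (p + m) * (A / p + B / m).
Proof.
move=> p0 m0 cA dB.
have mp : 0 <= m / p by rewrite divr_ge0// ltW.
have pm : 0 <= p / m by rewrite divr_ge0// ltW.
have -> : (p + m) * (A / p + B / m) = A + B + (m / p * A + p / m * B).
  by field; rewrite !gt_eqF.
rewrite lerD2l.
apply: (@le_trans _ _ (m / p * c ^+ 2 + p / m * d ^+ 2)); last first.
  by rewrite lerD// ler_wpM2l.
rewrite -subr_ge0; have -> : m / p * c ^+ 2 + p / m * d ^+ 2 - 2 * (c * d) =
    (m * c - p * d) ^+ 2 / (p * m) by field; rewrite !gt_eqF.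
by rewrite divr_ge0 ?sqr_ge0// mulr_ge0// ltW.
Qed.

Lemma pred_sqr_le (u : R) K : (u * K.-1%:R) ^+ 2 <= u ^+ 2 * (K * K.-1)%:R.
Proof.
rewrite exprMn ler_wpM2l ?sqr_ge0// -natrX ler_nat.
by rewrite -mulnn leq_mul2r leq_pred orbT.
Qed.

Lemma pair_weights_ge (u v : R) (K L p m n : nat) :
  0 < u -> 0 < v -> (K <= p)%N -> (L <= m)%N -> (p + m <= n)%N ->
  n%:R^-1 * (u ^+ 2 * (K * K.-1)%:R + v ^+ 2 * (L * L.-1)%:R +
             2 * (u * v) * (K.-1 * L.-1)%:R) <=
  p%:R^-1 * (u ^+ 2 * (K * K.-1)%:R) + m%:R^-1 * (v ^+ 2 * (L * L.-1)%:R).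
Proof.
move=> u0 v0 Kp Lm pmn.
have inv (q : nat) (x : R) : (0 < q)%N -> (q <= n)%N -> 0 <= x ->
    n%:R^-1 * x <= q%:R^-1 * x.
  move=> q0 qn x0; rewrite ler_wpM2r// lef_pV2 ?posrE ?ltr0n ?ler_nat//.
  exact: leq_trans q0 qn.
have A0 : 0 <= u ^+ 2 * (K * K.-1)%:R by rewrite mulr_ge0// sqr_ge0.
have B0 : 0 <= v ^+ 2 * (L * L.-1)%:R by rewrite mulr_ge0// sqr_ge0.
have [p0|p0] := posnP p.
  have -> : K = 0%N by lia.
  rewrite /= !mul0n !mulr0 add0r addr0 add0r.
  have [m0|m0] := posnP m; last by apply: inv => //; rewrite -(addn0 m) addnC -p0.
  have -> : L = 0%N by lia.
  by rewrite !mul0n !mulr0.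
have [m0|m0] := posnP m.
  have -> : L = 0%N by lia.
  rewrite /= mul0n muln0 !mulr0 !addr0; apply: inv => //; lia.
have pR : 0 < p%:R :> R by rewrite ltr0n.
have mR : 0 < m%:R :> R by rewrite ltr0n.
have pmR : 0 < p%:R + m%:R :> R by rewrite addr_gt0.
have := weighted_squares_ge _ _ _ _ _ _ pR mR (pred_sqr_le u K) (pred_sqr_le v L).
have -> : 2 * (u * K.-1%:R * (v * L.-1%:R)) = 2 * (u * v) * (K.-1 * L.-1)%:R.
  by rewrite natrM; ring.
rewrite -ler_pdivrMl// => H.
rewrite ![_^-1 * (_ * _%:R)]mulrC; apply: le_trans H; rewrite -natrD; apply: inv => //; first lia.
by rewrite !addr_ge0// !mulr_ge0// ltW.
Qed.

(** The product of predecessors is a polynomial, up to the two cases where the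
    bridge sits at an end point. *)
Lemma pred_mul_natE (K L : nat) : (K.-1 * L.-1)%:R = (K * L)%:R -
  (K + L).-1%:R * (1 - (K == 0%N)%:R - (L == 0%N)%:R) :> R.
Proof.
case: K L => [|K] [|L] /=; rewrite ?mul0n ?muln0 ?natrM ?addn0 ?add0n /=; ring.
Qed.

Lemma geometric_gap (N : nat) (t : R) : (0 < N)%N ->
  1 - t ^+ N - (1 - t) ^+ N =
  t * (1 - t) * \sum_(k < N.-1) (t ^+ k + (1 - t) ^+ k).
Proof.
case: N => // N _ /=; rewrite big_split /= mulrDr.
have H (u : R) : u * ((1 - u) * \sum_(k < N) u ^+ k) = u - u ^+ N.+1.
  have := subrX1 u N; rewrite -opprB -[u - 1]opprB mulNr => /oppr_inj <-.
  by rewrite mulrBr mulr1 exprS.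
have := H t; rewrite mulrA => ->; have := H (1 - t); rewrite subKr mulrA [(1 - t) * t]mulrC => ->.
ring.
Qed.

Context {n : nat}.

Lemma sum_pair_moment (t : R) (x y : cube n) : 0 < t < 1 ->
  \sum_z bridge_kernel t x y z *
    ((1 - t)^-1 ^+ 2 * (hamming z y * (hamming z y).-1)%:R +
     t^-1 ^+ 2 * (hamming x z * (hamming x z).-1)%:R +
     2 * ((1 - t)^-1 * t^-1) * ((hamming z y).-1 * (hamming x z).-1)%:R) =
  pair_moment (hamming x y) t.
Proof.
move=> /andP[t0 t1]; have tN : t != 0 by rewrite gt_eqF.
have t1N : 1 - t != 0 by rewrite gt_eqF// subr_gt0.
set N := hamming x y; have [M1 M2 M3] := bridge_moments t x y; rewrite -/N in M1 M2 M3.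
have at_y : \sum_z bridge_kernel t x y z * (hamming z y == 0%N)%:R = t ^+ N.
  rewrite (bigD1 y)//= big1 ?addr0 => [|z zy]; last first.
    by rewrite hamming_eq0 (negbTE zy) mulr0.
  rewrite hamming_eq0 eqxx mulr1 /bridge_kernel inE.
  have /eqP -> : hamming y y == 0%N by rewrite hamming_eq0.
  by rewrite addn0 eqxx mul1r expr0 mulr1.
have at_x : \sum_z bridge_kernel t x y z * (hamming x z == 0%N)%:R = (1 - t) ^+ N.
  rewrite (bigD1 x)//= big1 ?addr0 => [|z zx]; last first.
    by rewrite hamming_eq0 eq_sym (negbTE zx) mulr0.
  rewrite hamming_eq0 eqxx mulr1 /bridge_kernel inE.
  have /eqP -> : hamming x x == 0%N by rewrite hamming_eq0.
  by rewrite add0n eqxx mul1r expr0 mul1r.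
transitivity ((1 - t)^-1 ^+ 2 * ((1 - t) ^+ 2 * (N * N.-1)%:R) +
  t^-1 ^+ 2 * (t ^+ 2 * (N * N.-1)%:R) + 2 * ((1 - t)^-1 * t^-1) *
  (t * (1 - t) * (N * N.-1)%:R - N.-1%:R * (\sum_z bridge_kernel t x y z - t ^+ N - (1 - t) ^+ N))).
  rewrite -M1 -M2 -M3 -at_y -at_x -!sumrB !mulr_sumr.
  rewrite -sumrB mulr_sumr -!big_split /=; apply: eq_bigr => z _.
  rewrite pred_mul_natE; have [/segment_hamming zs|zs] := boolP (z \in segment x y).
    by rewrite [(hamming z y + _)%N]addnC zs -/N [(hamming z y * hamming x z)%N]mulnC; ring.
  by rewrite /bridge_kernel (negbTE zs) !mul0r; ring.
rewrite bridge_kernel_sum /pair_moment; have [N0|N0] := posnP N.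
  by rewrite N0 /= mul0n; ring.
rewrite geometric_gap//; field; exact/andP.
Qed.

End PairMoments.

Section LowerBounds.
Context {R : realType} {n : nat}.
Variables (p : cube n -> cube n -> R) (t : R).
Hypothesis ht : 0 < t < 1.
Hypothesis p_ge0 : forall x y, 0 <= p x y.
Hypothesis p_memoryless : memoryless p.
Implicit Types (x y z : cube n) (i j : 'I_n).

Let Sout z := [set i | flux_out p t i z != 0].
Let Sin z := [set i | flux_in p t i z != 0].

Let t_gt0 : 0 < t. Proof. by case/andP: ht. Qed.
Let t1_gt0 : 0 < 1 - t. Proof. by rewrite subr_gt0; case/andP: ht. Qed.

Lemma pairs_flux_out2 z : \sum_i \sum_(j | j != i) flux_out2 p t i j z =
  bridge_mean p t (fun _ y => (1 - t)^-1 ^+ 2 * (hamming z y * (hamming z y).-1)%:R) z.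
Proof.
rewrite bridge_meanZ mulrC exprVn.
under eq_bigr do rewrite -mulr_suml; rewrite -mulr_suml; congr (_ / _).
under eq_bigr do rewrite -bridge_mean_sum; rewrite -bridge_mean_sum.
by apply: eq_bridge_mean => x y; rewrite sum_pairs_bool.
Qed.

Lemma pairs_flux_in2 z : \sum_i \sum_(j | j != i) flux_in2 p t i j z =
  bridge_mean p t (fun x _ => t^-1 ^+ 2 * (hamming x z * (hamming x z).-1)%:R) z.
Proof.
rewrite bridge_meanZ mulrC exprVn.
under eq_bigr do rewrite -mulr_suml; rewrite -mulr_suml; congr (_ / _).
under eq_bigr do rewrite -bridge_mean_sum; rewrite -bridge_mean_sum.
by apply: eq_bridge_mean => x y; rewrite sum_pairs_bool.
Qed.

Lemma card_Sout_Sin z : (#|Sout z| + #|Sin z| <= n)%N.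
Proof.
have dis : [disjoint Sout z & Sin z].
  rewrite -setI_eq0; apply/eqP/setP => i; rewrite !inE; apply/negbTE/negP => /andP[oi ii].
  by move: (mulf_neq0 oi ii); rewrite flux_out_in ?eqxx.
have [_] := leq_card_setU (Sout z) (Sin z); rewrite dis => /eqP <-.
by rewrite -[X in (_ <= X)%N]card_ord max_card.
Qed.

Let weight_neq0 x y z F : p x y * bridge_kernel t x y z != 0 ->
  (forall u v, 0 <= F u v) -> F x y != 0 -> bridge_mean p t F z != 0.
Proof.
move=> W F0 Fxy; apply/eqP => H; move: (mulf_neq0 W Fxy).
by rewrite (bridge_mean_eq0P p t ht p_ge0 F z F0 H) eqxx.
Qed.

Let hamming_card (u v : cube n) (A : {set 'I_n}) :
  (forall i, u i != v i -> i \in A) -> (hamming u v <= #|A|)%N.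
Proof.
move=> H; rewrite -sum1_card big_mkcond /= leq_sum// => i _.
by have := H i; case: (u i != v i) => // ->.
Qed.

Lemma hamming_le_Sout x y z :
  p x y * bridge_kernel t x y z != 0 -> (hamming z y <= #|Sout z|)%N.
Proof.
move=> W; apply: hamming_card => i zy; rewrite inE; apply: mulf_neq0; last by rewrite invr_neq0// gt_eqF.
by apply: (weight_neq0 _ _ _ (fun _ y => (z i != y i)%:R) W) => //=; rewrite zy oner_eq0.
Qed.

Lemma hamming_le_Sin x y z :
  p x y * bridge_kernel t x y z != 0 -> (hamming x z <= #|Sin z|)%N.
Proof.
move=> W; apply: hamming_card => i zx; rewrite inE; apply: mulf_neq0; last by rewrite invr_neq0// gt_eqF.
by apply: (weight_neq0 _ _ _ (fun x _ => (x i != z i)%:R) W) => //=; rewrite zx oner_eq0.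
Qed.

(** The bound [squares_excess_ge] divides the second-order forward flux at [z] by
    the number of coordinates with a forward flux, and the backward one by the
    number of those with a backward flux. These two numbers add up to at most [n], whence the
    cross term of [pair_moment]. *)
Lemma second_variation_ge_moments :
  n%:R^-1 * \sum_x \sum_y p x y * pair_moment (hamming x y) t <=
  \sum_z (action_out p t z + action_in p t z).
Proof.
pose A x y z : R := (1 - t)^-1 ^+ 2 * (hamming z y * (hamming z y).-1)%:R.
pose B x y z : R := t^-1 ^+ 2 * (hamming x z * (hamming x z).-1)%:R.
pose C x y z : R := 2 * ((1 - t)^-1 * t^-1) * ((hamming z y).-1 * (hamming x z).-1)%:R.
have pt z : bridge_mean p t (fun x y => n%:R^-1 * (A x y z + B x y z + C x y z)) z <=
    action_out p t z + action_in p t z.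
  apply: (@le_trans _ _ (#|Sout z|%:R^-1 * bridge_mean p t (fun x y => A x y z) z +
      #|Sin z|%:R^-1 * bridge_mean p t (fun x y => B x y z) z)); last first.
    rewrite -pairs_flux_out2 -pairs_flux_in2; apply: lerD; apply: squares_excess_ge.
    - exact: bridge_ge0.
    - by move=> i; exact: flux_out_ge0.
    - by move=> i j; exact: flux_out2_ge0.
    - by move=> i j; exact: flux_out2_neq0.
    - exact: bridge_ge0.
    - by move=> i; exact: flux_in_ge0.
    - by move=> i j; exact: flux_in2_ge0.
    - by move=> i j; exact: flux_in2_neq0.
  rewrite -!bridge_meanZ /bridge_mean -big_split /=; apply: ler_sum => x _.
  rewrite -big_split /=; apply: ler_sum => y _; rewrite -mulrDr.
  have [->|W] := eqVneq (p x y * bridge_kernel t x y z) 0; first by rewrite !mul0r.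
  rewrite ler_wpM2l ?bridge_weight_ge0//; apply: pair_weights_ge.
  - by rewrite invr_gt0.
  - by rewrite invr_gt0.
  - exact: hamming_le_Sout W.
  - exact: hamming_le_Sin W.
  - exact: card_Sout_Sin.
apply: le_trans (ler_sum _ (fun z _ => pt z)).
rewrite (sum_bridge_mean p t (fun z x y => n%:R^-1 * (A x y z + B x y z + C x y z))).
rewrite mulr_sumr le_eqVlt; apply/orP; left; apply/eqP; apply: eq_bigr => x _.
rewrite mulr_sumr; apply: eq_bigr => y _.
rewrite -(sum_pair_moment t x y ht) mulrCA; congr (_ * _).
by rewrite mulr_sumr; apply: eq_bigr => z _; rewrite mulrCA.
Qed.

End LowerBounds.

(** * Convexity gap of the pair moments *)

Section BridgePolynomials.
Context {R : realType}.
Implicit Types (s t : R) (K L N k : nat).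

Definition bernstein L K : {poly R} := 'X^L * (1 - 'X) ^+ K.

Lemma bernsteinE L K s : (bernstein L K).[s] = s ^+ L * (1 - s) ^+ K.
Proof. by rewrite /bernstein hornerM horner_exp !hornerE. Qed.

Lemma deriv_bernstein L K :
  (bernstein L K)^`() = bernstein L.-1 K *+ L - bernstein L K.-1 *+ K.
Proof.
rewrite derivM derivXn deriv_exp derivB derivC derivX sub0r mulN1r mulNrn mulrN.
by rewrite -mulrnAl -mulrnAr.
Qed.

Let natr_expr_pred L s : s != 0 -> L%:R * s ^+ L.-1 = L%:R * (s ^+ L / s).
Proof.
by move=> s0; case: L => [|L]; rewrite ?mul0r//= exprSr mulfK.
Qed.

Lemma deriv_bernsteinE L K s : s != 0 -> 1 - s != 0 ->
  (bernstein L K)^`().[s] = (bernstein L K).[s] * (L%:R / s - K%:R / (1 - s)).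
Proof.
move=> s0 s1; rewrite deriv_bernstein hornerD hornerN !hornerMn !bernsteinE.
transitivity (L%:R * s ^+ L.-1 * (1 - s) ^+ K - s ^+ L * (K%:R * (1 - s) ^+ K.-1)).
  by rewrite -[_ *+ L]mulr_natl -[_ *+ K]mulr_natl; ring.
by rewrite !natr_expr_pred//; ring.
Qed.

Lemma deriv2_bernsteinE L K s : s != 0 -> 1 - s != 0 ->
  (bernstein L K)^`()^`().[s] = (bernstein L K).[s] *
    ((L * L.-1)%:R / s ^+ 2 + (K * K.-1)%:R / (1 - s) ^+ 2 -
     2 * (L * K)%:R / (s * (1 - s))).
Proof.
move=> s0 s1; rewrite deriv_bernstein derivB !derivMn hornerD hornerN !hornerMn.
rewrite !deriv_bernsteinE// !bernsteinE !natrM.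
transitivity (L%:R * s ^+ L.-1 * (1 - s) ^+ K * (L.-1%:R / s - K%:R / (1 - s)) -
    s ^+ L * (K%:R * (1 - s) ^+ K.-1) * (L%:R / s - K.-1%:R / (1 - s))).
  by rewrite -[_ *+ L]mulr_natl -[_ *+ K]mulr_natl; ring.
rewrite (natr_expr_pred L s s0) (natr_expr_pred K (1 - s) s1).
by field; apply/andP.
Qed.

Lemma second_derivative_bernstein L K : second_derivative
  (fun s => s ^+ L * (1 - s) ^+ K) (horner (bernstein L K)^`()^`()).
Proof.
have -> : (fun s => s ^+ L * (1 - s) ^+ K) = horner (bernstein L K).
  by apply/funext => s; rewrite bernsteinE.
exact: second_derivative_poly.
Qed.

Lemma second_derivative_expr k : second_derivative
  (fun s : R => s ^+ k.+2) (fun s => (k.+1 * k.+2)%:R * s ^+ k).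
Proof.
have := second_derivative_bernstein k.+2 0; congr second_derivative.
  by apply/funext => s; rewrite mulr1.
apply/funext => s; rewrite deriv_bernstein mulr0n subr0 derivMn deriv_bernstein.
by rewrite mulr0n subr0 -mulrnA hornerMn bernsteinE mulr1 mulr_natl.
Qed.

Lemma second_derivative_expr1B k : second_derivative
  (fun s : R => (1 - s) ^+ k.+2) (fun s => (k.+1 * k.+2)%:R * (1 - s) ^+ k).
Proof.
have := second_derivative_bernstein 0 k.+2; congr second_derivative.
  by apply/funext => s; rewrite mul1r.
apply/funext => s; rewrite deriv_bernstein mulr0n sub0r derivN derivMn deriv_bernstein.
by rewrite mulr0n sub0r mulNrn opprK -mulrnA hornerMn bernsteinE mul1r mulr_natl.
Qed.

(** A second primitive of [pair_moment N]. *)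
Definition pair_potential N s : R := 2 * (N * N.-1)%:R * s ^+ 2 +
  (- (2 * N.-1%:R)) *
  \sum_(k < N.-1) (k.+1 * k.+2)%:R^-1 * (s ^+ k.+2 + (1 - s) ^+ k.+2).

Lemma second_derivative_pair_potential N :
  second_derivative (pair_potential N) (pair_moment N).
Proof.
have -> : @pair_moment R N = (fun s => 2 * (N * N.-1)%:R * ((1 * 2)%:R * s ^+ 0) +
  (- (2 * N.-1%:R)) * \sum_(k < N.-1) (k.+1 * k.+2)%:R^-1 *
     ((k.+1 * k.+2)%:R * s ^+ k + (k.+1 * k.+2)%:R * (1 - s) ^+ k)).
  apply/funext => s; rewrite /pair_moment expr0 mulr1 mulNr; congr (_ - _).
    by rewrite mul1n; ring.
  congr (_ * _); apply: eq_bigr => k _.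
  by rewrite -mulrDr mulKf// pnatr_eq0 muln_eq0.
apply: second_derivativeD; first by apply: second_derivativeZ; exact: second_derivative_expr.
apply: second_derivativeZ; apply: second_derivative_sum => k _.
apply: second_derivativeZ; apply: second_derivativeD; first exact: second_derivative_expr.
exact: second_derivative_expr1B.
Qed.

Definition harmonic_sum M : R := \sum_(k < M) k.+1%:R^-1.

Lemma harmonic_sum_le_half M : 2 * harmonic_sum M <= M.+1%:R.
Proof.
rewrite /harmonic_sum; elim: M => [|M IH]; first by rewrite big_ord0 mulr0.
rewrite big_ord_recr /= mulrDr -[M.+2]addn1 natrD; case: M IH => [|M] IH.
  by rewrite big_ord0 invr1; lra.
apply: lerD IH _; rewrite ler_pdivrMr ?ltr0n// mul1r ler_nat; lia.
Qed.

Lemma harmonic_sum_le_ln M : harmonic_sum M.+1 <= 1 + ln M.+1%:R.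
Proof.
rewrite /harmonic_sum; elim: M => [|M IH]; first by rewrite big_ord1 invr1 ln1 addr0.
rewrite big_ord_recr /=; apply: (@le_trans _ _ (1 + ln M.+1%:R + M.+2%:R^-1)).
  exact: lerD.
have M1 : 0 < M.+1%:R :> R by rewrite ltr0n.
have M2 : 0 < M.+2%:R :> R by rewrite ltr0n.
have := le_1V_ln (M.+2%:R / M.+1%:R : R) (divr_gt0 M2 M1).
rewrite ln_div ?posrE// invf_div => H.
have E : 1 - M.+1%:R / M.+2%:R = M.+2%:R^-1 :> R.
  by rewrite -[M.+2]addn1 natrD; field; rewrite -natr1 in M2; rewrite gt_eqF.
by rewrite E in H; rewrite -addrA lerD2l -lerBrDl.
Qed.

(** The two branches of [c2] correspond to the bounds [N / 2] and [1 + ln N] of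
    the harmonic sum. *)
Lemma c2_le N : c2 N <= N.-1%:R * (N%:R - harmonic_sum N.-1) :> R.
Proof.
rewrite /c2; case: N => [|M] /=; first by rewrite !mulr0 !mul0r subr0 ge_max lexx expr0n lexx.
have H1 := harmonic_sum_le_half M.
have M0 : 0 <= M%:R :> R by [].
have ln0 : 0 <= ln M.+1%:R :> R by apply: ln_ge0; rewrite ler1n.
have H2 : M%:R * harmonic_sum M <= M%:R * (1 + ln M.+1%:R).
  case: M {H1} M0 ln0 => [|M] M0 ln0; first by rewrite !mul0r.
  rewrite ler_wpM2l//; apply: le_trans (harmonic_sum_le_ln M) _.
  by rewrite lerD2l ler_ln ?posrE ?ltr0n// ler_nat.
rewrite ge_max; apply/andP; split.
  have := ler_wpM2l M0 H1; rewrite -[M.+1]addn1 natrD; lra.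
rewrite mulr1; set l := ln _ in ln0 H2 *; have := mulr_ge0 M0 ln0.
by rewrite -[M.+1]addn1 natrD; lra.
Qed.

(** The gap of the [k]-th pair of powers is [1 - t ^+ k.+2 - (1 - t) ^+ k.+2], at
    most [k.+2 * (t * (1 - t))]; the coefficients then leave a harmonic sum. *)
Lemma gap_pair_potential N t : 0 < t < 1 ->
  2 * (t * (1 - t)) * c2 N <= gap (pair_potential N) t.
Proof.
move=> /andP[t0 t1]; have tt : 0 <= t * (1 - t) by rewrite mulr_ge0 ?subr_ge0 ?ltW.
apply: (@le_trans _ _ (2 * (t * (1 - t)) * (N.-1%:R * (N%:R - harmonic_sum N.-1)))).
  by rewrite ler_wpM2l ?c2_le// mulr_ge0.
rewrite /pair_potential gapD !gapZ gap_sum.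
have gap2 : gap (fun s => s ^+ 2) t = t * (1 - t) by rewrite /gap; ring.
rewrite gap2 mulNr.
have H : \sum_(k < N.-1) gap (fun s => (k.+1 * k.+2)%:R^-1 * (s ^+ k.+2 + (1 - s) ^+ k.+2)) t
    <= t * (1 - t) * harmonic_sum N.-1.
  rewrite /harmonic_sum mulr_sumr; apply: ler_sum => k _; rewrite gapZ.
  have -> : gap (fun s => s ^+ k.+2 + (1 - s) ^+ k.+2) t = 1 - t ^+ k.+2 - (1 - t) ^+ k.+2.
    by rewrite /gap subr0 subrr !expr1n !expr0n /=; ring.
  rewrite geometric_gap// mulrCA ler_wpM2l//= natrM invfM -mulrA ler_piMr ?invr_ge0//.
  rewrite ler_pdivrMl ?ltr0n// mulr1 big_ord_recl /= !expr0.
  (* Only the constant powers add up to [2], all others to at most [1]. *)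
  apply: (@le_trans _ _ (1 + 1 + \sum_(i < k) 1)).
    rewrite lerD2l; apply: ler_sum => i _; rewrite !exprS.
    apply: (@le_trans _ _ (t * 1 + (1 - t) * 1)); last by rewrite !mulr1 addrC subrK.
    apply: lerD; apply: ler_wpM2l; rewrite ?subr_ge0 ?(ltW t0) ?(ltW t1)//.
      by rewrite exprn_ile1 ?(ltW t0) ?(ltW t1).
    by rewrite exprn_ile1 ?subr_ge0 ?(ltW t1)// gerBl ltW.
  by rewrite sumr_const card_ord -addrA -[k.+2]addn2 addnC natrD; lra.
have N0 : 0 <= 2 * N.-1%:R :> R by rewrite mulr_ge0.
have := ler_wpM2l N0 H; rewrite natrM; lra.
Qed.

End BridgePolynomials.

(** * The convexity gap of the entropy *)

Section EntropyGap.
Context {R : realType} {n : nat}.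
Variables (nu0 nu1 : cube n -> R) (p : cube n -> cube n -> R).
Hypothesis p_coupling : is_coupling nu0 nu1 p.
Hypothesis p_memoryless : memoryless p.
Implicit Types (x y z : cube n) (i j : 'I_n) (s t : R).

Let p_ge0 x y : 0 <= p x y. Proof. by case: p_coupling. Qed.
Let nu0E x : \sum_y p x y = nu0 x. Proof. by case: p_coupling. Qed.
Let nu1E y : \sum_x p x y = nu1 y. Proof. by case: p_coupling. Qed.

Definition bridge_poly z : {poly R} := \sum_x \sum_y
  (p x y * (z \in segment x y)%:R) *: bernstein (hamming x z) (hamming z y).

Lemma bridge_polyE s z : (bridge_poly z).[s] = bridge p s z.
Proof.
rewrite horner_sum; apply: eq_bigr => x _; rewrite horner_sum; apply: eq_bigr => y _.
by rewrite hornerZ bernsteinE /bridge_kernel; ring.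
Qed.

Lemma bridge_poly_d1 s z : 0 < s < 1 -> (bridge_poly z)^`().[s] = bridge_d1 p s z.
Proof.
move=> /andP[s0 s1]; have s0' : s != 0 by rewrite gt_eqF.
have s1' : 1 - s != 0 by rewrite gt_eqF// subr_gt0.
have -> : bridge_d1 p s z = bridge_mean p s (fun x _ => (hamming x z)%:R) z / s -
   bridge_mean p s (fun _ y => (hamming z y)%:R) z / (1 - s).
  rewrite /bridge_d1 sumrB; congr (_ - _); rewrite -mulr_suml; congr (_ / _);
  rewrite -bridge_mean_sum; apply: eq_bridge_mean => x y; by rewrite natr_sum.
rewrite !mulr_suml -sumrB raddf_sum horner_sum; apply: eq_bigr => x _.
rewrite !mulr_suml -sumrB raddf_sum horner_sum; apply: eq_bigr => y _.
rewrite /= derivZ hornerZ deriv_bernsteinE// bernsteinE /bridge_kernel; ring.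
Qed.

Lemma bridge_poly_d2 s z : 0 < s < 1 -> (bridge_poly z)^`()^`().[s] = bridge_d2 p s z.
Proof.
move=> /andP[s0 s1]; have s0' : s != 0 by rewrite gt_eqF.
have s1' : 1 - s != 0 by rewrite gt_eqF// subr_gt0.
have thr : \sum_i \sum_(j | j != i) flux_through p s i j z =
    bridge_mean p s (fun x y => (hamming x z * hamming z y)%:R) z / (s * (1 - s)).
  transitivity (\sum_i \sum_j flux_through p s i j z).
    by apply: eq_bigr => i _; rewrite [RHS](bigD1 i)//= flux_through_diag add0r.
  rewrite exchange_big /=.
  under eq_bigr do rewrite -mulr_suml; rewrite -mulr_suml; congr (_ / _).
  under eq_bigr do rewrite -bridge_mean_sum; rewrite -bridge_mean_sum.
  apply: eq_bridge_mean => x y; rewrite natrM /hamming !natr_sum mulr_suml.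
  by congr (_ * _); apply: eq_bigr => i _; rewrite mulr_sumr.
have thr' : \sum_i \sum_(j | j != i) flux_through p s j i z =
    \sum_i \sum_(j | j != i) flux_through p s i j z.
  rewrite (exchange_big_dep predT)//=; apply: eq_bigr => i _.
  by apply: eq_bigl => j; rewrite eq_sym.
have -> : bridge_d2 p s z =
   bridge_mean p s (fun _ y => (1 - s)^-1 ^+ 2 * (hamming z y * (hamming z y).-1)%:R) z +
   bridge_mean p s (fun x _ => s^-1 ^+ 2 * (hamming x z * (hamming x z).-1)%:R) z -
   2 * (bridge_mean p s (fun x y => (hamming x z * hamming z y)%:R) z / (s * (1 - s))).
  rewrite /bridge_d2; under eq_bigr do rewrite !sumrB big_split /=.
  rewrite !sumrB big_split /= pairs_flux_out2 pairs_flux_in2 thr' thr; ring.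
rewrite mulr_suml mulr_sumr -big_split -sumrB /= !raddf_sum horner_sum /=; apply: eq_bigr => x _.
rewrite mulr_suml mulr_sumr -big_split -sumrB /= !raddf_sum horner_sum /=; apply: eq_bigr => y _.
rewrite !derivZ hornerZ deriv2_bernsteinE// bernsteinE /bridge_kernel; field.
exact/andP.
Qed.

(** Entropy relative to the counting measure. *)
Definition bridge_shannon s : R := \sum_z bridge p s z * ln (bridge p s z).

(** A vertex is charged either at all interior times or at none, so that
    [x * ln x] is only differentiated at positive values. *)
Lemma second_derivative_bridge_shannon : exists2 f2, second_derivative bridge_shannon f2 &
  forall s, 0 < s < 1 -> f2 s = \sum_z (action_out p s z + action_in p s z).
Proof.
pose q := bridge_poly.
exists (fun s => \sum_z ((q z)^`()^`().[s] * (ln (q z).[s] + 1) + (q z)^`().[s] ^+ 2 / (q z).[s])).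
  have -> : bridge_shannon = fun s => \sum_z (q z).[s] * ln (q z).[s].
    by apply/funext => s; apply: eq_bigr => z _; rewrite bridge_polyE.
  apply: second_derivative_sum => z _.
  have [/existsP[x /existsP[y xy]] | H] :=
      boolP [exists x, [exists y, p x y * (z \in segment x y)%:R != 0]].
    apply: second_derivative_xlnx => s s01; rewrite bridge_polyE.
    have t0 u v : 0 <= bridge_kernel s u v z * p u v.
      by rewrite mulr_ge0 ?bridge_kernel_ge0.
    rewrite /bridge (bigD1 x)//= ltr_pwDl ?sumr_ge0// => [|u _]; last by rewrite sumr_ge0.
    rewrite (bigD1 y)//= ltr_pwDl ?sumr_ge0// lt0r t0 andbT.
    move: xy; rewrite !mulf_eq0 !negb_or /bridge_kernel => /andP[-> ->].
    by case/andP: s01 => s0 s1; rewrite /= !expf_neq0// gt_eqF// subr_gt0.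
  have -> : q z = 0.
    apply: big1 => x _; apply: big1 => y _.
    move: H; rewrite negb_exists => /forallP/(_ x); rewrite negb_exists => /forallP/(_ y).
    by rewrite negbK => /eqP ->; rewrite scale0r.
  rewrite !deriv0; under eq_fun do rewrite horner0 mul0r.
  have := @second_derivative0 R; congr second_derivative.
  by apply/funext => s; rewrite !horner0 mul0r expr0n mul0r addr0.
move=> s s01; transitivity (\sum_z (bridge_d2 p s z * ln (bridge p s z) +
    bridge_d1 p s z ^+ 2 / bridge p s z) + \sum_z bridge_d2 p s z).
  rewrite -big_split /=.
  by apply: eq_bigr => z _; rewrite /q bridge_poly_d2// bridge_poly_d1// bridge_polyE; ring.
by rewrite sum_bridge_d2// addr0 second_variation.
Qed.

Lemma bridge_at0 z : bridge p 0 z = nu0 z.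
Proof.
rewrite /bridge (bigD1 z)//= [X in _ + X]big1 ?addr0; last first.
  move=> x xz; apply: big1 => y _; rewrite /bridge_kernel expr0n hamming_eq0 (negbTE xz).
  by rewrite mulr0 !mul0r.
rewrite -nu0E; apply: eq_bigr => y _; rewrite /bridge_kernel subr0 expr1n mulr1.
have /eqP hz : hamming z z == 0%N by rewrite hamming_eq0.
by rewrite inE hz add0n eqxx expr0 !mul1r.
Qed.

Lemma bridge_at1 z : bridge p 1 z = nu1 z.
Proof.
rewrite /bridge exchange_big (bigD1 z)//= [X in _ + X]big1 ?addr0; last first.
  move=> y yz; apply: big1 => x _.
  rewrite /bridge_kernel subrr expr0n hamming_eq0 eq_sym (negbTE yz).
  by rewrite mulr0 mul0r.
rewrite -nu1E; apply: eq_bigr => x _; rewrite /bridge_kernel subrr expr1n mulr1.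
have /eqP hz : hamming z z == 0%N by rewrite hamming_eq0.
by rewrite inE hz addn0 eqxx expr0 !mul1r.
Qed.

Lemma bridge_linear_stat (l : 'I_n -> bool -> R) t :
  \sum_z bridge p t z * (\sum_i l i (z i)) =
  (1 - t) * (\sum_x nu0 x * \sum_i l i (x i)) + t * (\sum_y nu1 y * \sum_i l i (y i)).
Proof.
have swap : \sum_y nu1 y * \sum_i l i (y i) = \sum_x \sum_y p x y * \sum_i l i (y i).
  by rewrite exchange_big; apply: eq_bigr => y _; rewrite -nu1E mulr_suml.
rewrite swap !mulr_sumr -big_split /=.
under eq_bigr do rewrite mulr_suml.
rewrite exchange_big /=; apply: eq_bigr => x _.
under eq_bigr do rewrite mulr_suml.
rewrite exchange_big -nu0E mulr_suml !mulr_sumr -big_split /=; apply: eq_bigr => y _.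
transitivity (p x y * \sum_z bridge_kernel t x y z * \sum_i l i (z i)).
  by rewrite mulr_sumr; apply: eq_bigr => z _; rewrite mulrAC mulrC mulrA.
by rewrite bridge_affine; ring.
Qed.

Variable alpha : 'I_n -> R.
Hypothesis halpha : forall i, 0 < alpha i < 1.
Let mu := product_measure alpha.

Let l i (b : bool) : R := ln (if b then alpha i else 1 - alpha i).

Let ln_mu z : ln (mu z) = \sum_i l i (z i).
Proof.
have w0 i : 0 < (if z i then alpha i else 1 - alpha i).
  by have /andP[? ?] := halpha i; case: (z i); rewrite ?subr_gt0.
suff [] : 0 < mu z /\ ln (mu z) = \sum_i l i (z i) by [].
rewrite /mu /product_measure.
elim/big_rec2: _ => [|i y1 y2 _ [y0 IH]]; first by rewrite ln1.
by rewrite mulr_gt0// lnM ?posrE// IH.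
Qed.

Let entropy_split (q : cube n -> R) : (forall z, 0 <= q z) ->
  entropy q mu = \sum_z q z * ln (q z) - \sum_z q z * \sum_i l i (z i).
Proof.
move=> q0; rewrite -sumrB; apply: eq_bigr => z _; rewrite -ln_mu -mulrBr.
have [->|qN] := eqVneq (q z) 0; first by rewrite !mul0r.
by rewrite ln_div ?posrE ?product_measure_gt0// lt0r qN q0.
Qed.

(** Since [mu] is a product, [ln mu] averages affinely along the bridge, so that
    only the entropy relative to the counting measure is seen by the gap. *)
Lemma entropy_gap t : 0 < t < 1 ->
  (1 - t) * entropy nu0 mu + t * entropy nu1 mu - entropy (bridge p t) mu =
  gap bridge_shannon t.
Proof.
move=> t01.
have nu0_ge0 z : 0 <= nu0 z by rewrite -nu0E sumr_ge0.
have nu1_ge0 z : 0 <= nu1 z by rewrite -nu1E sumr_ge0.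
rewrite !entropy_split//; last by move=> z; exact: bridge_ge0.
rewrite bridge_linear_stat /gap /bridge_shannon.
under [X in _ = _ * X + _ - _]eq_bigr do rewrite bridge_at0.
under [X in _ = _ + _ * X - _]eq_bigr do rewrite bridge_at1.
ring.
Qed.

Lemma gap_ge_cost t : 0 < t < 1 -> (0 < n)%N -> \sum_x nu0 x = 1 ->
  t * (1 - t) / 2 * (4 / n%:R * transport_cost p ^+ 2) <= gap bridge_shannon t.
Proof.
move=> t01 n0 nu01; have [f2 Hf2 f2E] := second_derivative_bridge_shannon.
set W := transport_cost p; pose g (s : R) := 2 / n%:R * W ^+ 2 * s ^+ 2.
have -> : t * (1 - t) / 2 * (4 / n%:R * W ^+ 2) = gap g t.
  by rewrite gapZ /gap; field; rewrite pnatr_eq0 -lt0n.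
apply: gap_le t01 Hf2 (second_derivativeZ _ _ _ (second_derivative_expr 0)) _ => s s01.
rewrite f2E//; have p1 : \sum_x \sum_y p x y = 1.
  by under eq_bigr do rewrite nu0E.
apply: le_trans (second_variation_ge_cost p s s01 p_ge0 p_memoryless n0 p1).
by rewrite -/W mul1n expr0; lra.
Qed.

Lemma gap_ge_pairs t : 0 < t < 1 ->
  t * (1 - t) / 2 * (4 / n%:R * T_c2 p) <= gap bridge_shannon t.
Proof.
move=> t01; have [f2 Hf2 f2E] := second_derivative_bridge_shannon.
pose g s := n%:R^-1 * \sum_x \sum_y p x y * pair_potential (hamming x y) s.
apply: (@le_trans _ _ (gap g t)).
  rewrite gapZ gap_sum /T_c2.
  rewrite [leLHS](_ : _ = n%:R^-1 *
    \sum_x \sum_y p x y * (2 * (t * (1 - t)) * c2 (hamming x y))).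
    rewrite ler_wpM2l ?invr_ge0//; apply: ler_sum => x _; rewrite gap_sum.
    apply: ler_sum => y _; rewrite gapZ ler_wpM2l//; exact: gap_pair_potential.
  rewrite [RHS](_ : _ = n%:R^-1 * (2 * (t * (1 - t)) * (\sum_x \sum_y c2 (hamming x y) * p x y))).
    by move: (n%:R^-1) => c; field.
  congr (_ * _); rewrite mulr_sumr; apply: eq_bigr => x _; rewrite mulr_sumr.
  by apply: eq_bigr => y _; ring.
apply: (gap_le _ _ _ (fun s => n%:R^-1 * \sum_x \sum_y p x y * pair_moment (hamming x y) s) _ t01 Hf2).
  apply: second_derivativeZ; apply: second_derivative_sum => x _.
  apply: second_derivative_sum => y _; apply: second_derivativeZ.
  exact: second_derivative_pair_potential.
by move=> s s01; rewrite f2E//; exact: second_variation_ge_moments.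
Qed.

End EntropyGap.

Section JumpCost.
Context {R : realType}.
Implicit Types (u s t : R).

(** Entropy term of the probability [1 - s * u] that a coordinate which flips
    with probability [u] has not done so by time [s]; up to affine terms this is
    half of [hfun (s * u)]. *)
Definition survival u s : R := (1 - s * u) * ln (1 - s * u).

Let second_derivative_affine (a b : R) : (forall s, 0 < s < 1 -> 0 < a + s * b) ->
  second_derivative (fun s => (a + s * b) * ln (a + s * b)) (fun s => b ^+ 2 / (a + s * b)).
Proof.
move=> ab; pose q : {poly R} := a%:P + b *: 'X.
have qE s : q.[s] = a + s * b by rewrite !hornerE mulrC.
have q1 : q^`() = b%:P by rewrite derivD derivC derivZ derivX add0r alg_polyC.
have q0 s : 0 < s < 1 -> 0 < q.[s] by rewrite qE; exact: ab.
have := second_derivative_xlnx q q0.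
congr second_derivative; apply/funext => s; rewrite qE//.
by rewrite q1 derivC horner0 mul0r add0r hornerC.
Qed.

Let survival_gt0 u s : 0 <= u <= 1 -> 0 < s < 1 -> 0 < 1 - s * u.
Proof.
move=> /andP[u0 u1] /andP[s0 s1].
by rewrite subr_gt0 (le_lt_trans _ s1)// ler_piMr// ltW.
Qed.

Lemma second_derivative_survival u : 0 <= u <= 1 ->
  second_derivative (survival u) (fun s => u ^+ 2 / (1 - s * u)).
Proof.
move=> u01; have H s : 0 < s < 1 -> 0 < 1 + s * - u.
  by rewrite mulrN; exact: survival_gt0.
have := second_derivative_affine 1 (- u) H.
by congr second_derivative; apply/funext => s; rewrite mulrN ?sqrrN.
Qed.

Lemma second_derivative_survival_rev u : 0 <= u <= 1 ->
  second_derivative (fun s => survival u (1 - s)) (fun s => u ^+ 2 / (1 - (1 - s) * u)).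
Proof.
move=> u01; have E s : 1 - u + s * u = 1 - (1 - s) * u by ring.
have H s : 0 < s < 1 -> 0 < 1 - u + s * u.
  by rewrite E => /andP[s0 s1]; apply: survival_gt0 => //; apply/andP; split; lra.
have := second_derivative_affine (1 - u) u H.
by congr second_derivative; apply/funext => s; rewrite E.
Qed.

Lemma gap_survival u t : 0 < t < 1 ->
  gap (survival u) t = t * (1 - t) / 2 * hfun_t t u.
Proof.
move=> /andP[t0 t1]; rewrite /gap /survival /hfun_t /hfun !mul0r !subr0 ln1 !mul1r.
by field; rewrite !gt_eqF// subr_gt0.
Qed.

Lemma gap_survival_rev u t : 0 < t < 1 ->
  gap (fun s => survival u (1 - s)) t = t * (1 - t) / 2 * hfun_t (1 - t) u.
Proof.
move=> /andP[t0 t1].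
have t1' : 0 < 1 - t < 1 by apply/andP; split; lra.
have -> : gap (fun s => survival u (1 - s)) t = gap (survival u) (1 - t).
  by rewrite /gap subr0 subrr subKr; ring.
by rewrite gap_survival// subKr [(1 - t) * t]mulrC.
Qed.

End JumpCost.

Section JumpBound.
Context {R : realType} {n : nat}.
Variables (nu0 nu1 : cube n -> R) (p : cube n -> cube n -> R).
Hypothesis p_coupling : is_coupling nu0 nu1 p.
Hypothesis p_memoryless : memoryless p.

(** The backward half is the forward one for the time-reversed coupling. *)
Lemma gap_ge_jumps t : 0 < t < 1 ->
  t * (1 - t) / 2 * T_tilde nu0 nu1 p t <= gap (bridge_shannon p) t.
Proof.
move=> t01; have [p_ge0 nu0E nu1E] := p_coupling.
pose p' x y := p y x.
have p'_ge0 x y : 0 <= p' x y by exact: p_ge0.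
have p'_mem : memoryless p' by exact: memoryless_tr.
have nu0_ge0 x : 0 <= nu0 x by rewrite -nu0E sumr_ge0.
have nu1_ge0 x : 0 <= nu1 x by rewrite -nu1E sumr_ge0.
have F01 i x : 0 <= Pi_forward nu0 p i x <= 1.
  by rewrite Pi_forward_ge0 ?Pi_forward_le1.
have B01 i y : 0 <= Pi_backward nu1 p i y <= 1.
  by have := Pi_forward_ge0 p' p'_ge0 nu1 nu1E i y;
    have := Pi_forward_le1 p' p'_ge0 nu1 nu1E i y => ? ?; apply/andP.
have [f2 Hf2 f2E] := second_derivative_bridge_shannon _ _ _ p_coupling p_memoryless.
pose g (s : R) := \sum_x \sum_(i < n) nu0 x * survival (Pi_forward nu0 p i x) s +
  \sum_y \sum_(i < n) nu1 y * survival (Pi_backward nu1 p i y) (1 - s).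
have -> : t * (1 - t) / 2 * T_tilde nu0 nu1 p t = gap g t.
  rewrite gapD !gap_sum /T_tilde mulrDr !mulr_sumr; congr (_ + _); apply: eq_bigr => x _.
    rewrite gap_sum mulr_suml mulr_sumr; apply: eq_bigr => i _.
    by rewrite gapZ gap_survival//; ring.
  rewrite gap_sum mulr_suml mulr_sumr; apply: eq_bigr => i _.
  by rewrite gapZ gap_survival_rev//; ring.
pose g2 (s : R) := \sum_x \sum_(i < n) nu0 x *
    (Pi_forward nu0 p i x ^+ 2 / (1 - s * Pi_forward nu0 p i x)) +
  \sum_y \sum_(i < n) nu1 y *
    (Pi_backward nu1 p i y ^+ 2 / (1 - (1 - s) * Pi_backward nu1 p i y)).
apply: (gap_le _ _ _ g2 _ t01 Hf2).
  apply: second_derivativeD; apply: second_derivative_sum => x _;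
    apply: second_derivative_sum => i _; apply: second_derivativeZ.
    exact: second_derivative_survival.
  exact: second_derivative_survival_rev.
move=> s s01; have s01' : 0 < 1 - s < 1 by case/andP: s01 => ? ?; apply/andP; split; lra.
rewrite f2E// big_split /=; apply: lerD.
  apply: le_trans (forward_speed_ge p s s01 p_ge0 p_memoryless nu0 nu0E) _.
  by apply: ler_sum => z _; exact: action_out_ge.
apply: le_trans (forward_speed_ge p' (1 - s) s01' p'_ge0 p'_mem nu1 nu1E) _.
apply: ler_sum => z _; apply: le_trans (action_in_ge _ _ s01 p_ge0 z).
by apply: ler_sum => i _; rewrite flux_in_tr (bridge_tr p s).
Qed.

End JumpBound.

Lemma W1_sqr_le {R : realType} {n : nat} (nu0 nu1 : cube n -> R) (p : cube n -> cube n -> R) :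
  is_coupling nu0 nu1 p -> W1 nu0 nu1 ^+ 2 <= transport_cost p ^+ 2.
Proof.
move=> hp; pose E := [set transport_cost q | q in [set q | is_coupling nu0 nu1 q]]%classic.
have E0 : lbound E 0.
  by move=> _ [q [q0 _ _] <-]; do 2!apply: sumr_ge0 => ? _; rewrite mulr_ge0.
have Ep : E (transport_cost p) by exists p.
have W0 : 0 <= W1 nu0 nu1 by apply: lb_le_inf => //; exists (transport_cost p).
have Wp : W1 nu0 nu1 <= transport_cost p by apply: ge_inf => //; exists 0.
by rewrite ler_pXn2r// nnegrE// (le_trans W0 Wp).
Qed.

Theorem theorem2p5 (R : realType) (n : nat) (alpha : 'I_n -> R)
    (nu0 nu1 : cube n -> R) (pihat : cube n -> cube n -> R)
    (hn : (1 <= n)%N)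
    (halpha : forall i, 0 < alpha i < 1)
    (hnu0 : is_prob nu0) (hnu1 : is_prob nu1)
    (hpihat : zero_temperature_coupling alpha nu0 nu1 pihat)
    (t : R) (ht : 0 < t < 1) :
  let mu := product_measure alpha in
  entropy (bridge pihat t) mu <=
    (1 - t) * entropy nu0 mu + t * entropy nu1 mu
    - t * (1 - t) / 2 * C_cost nu0 nu1 pihat t.
Proof.
rewrite /=.
have cpl := zero_temperature_is_coupling alpha halpha nu0 nu1 pihat hpihat.
have mem := zero_temperature_memoryless alpha halpha nu0 nu1 pihat hpihat.
have [_ nu01] := hnu0.
rewrite lerBrDr -lerBrDl (entropy_gap _ _ _ cpl _ halpha)//.
have tt : 0 <= t * (1 - t) / 2.
  by case/andP: ht => t0 t1; rewrite divr_ge0// mulr_ge0 ?subr_ge0// ltW.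
rewrite /C_cost !maxr_pMr// !ge_max; apply/and3P; split.
- apply: le_trans (gap_ge_cost _ _ _ cpl mem t ht hn nu01).
  by rewrite ler_wpM2l// ler_wpM2l ?divr_ge0//; exact: W1_sqr_le.
- exact: gap_ge_pairs cpl mem t ht.
- exact: gap_ge_jumps.
Qed.
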